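(* There is a Polish dynamical system $(X,T)$ and a closed, connected, nonempty $V\subseteq\mathcal{M}_T(X)$ such that $G(V)$ is $\boldsymbol{\Pi}^1_1$-complete. In fact, we may take $V=\{\mu\}$ for some $\mu\in\mathcal{M}_T(X)$, and $(X,T)$ to have the specification property. Furthermore, setting $U=\{\nu\in\mathcal{M}_T(X):\nu\neq\mu\}$, we obtain that $G_V$ is $\boldsymbol{\Pi}^1_1$-complete and ${}^{U}G$ is $\boldsymbol{\Sigma}^1_1$-complete.
   Context: A Polish dynamical system $(X,T)$ is a Polish space $X$ with a fixed compatible complete metric $\rho$ and a continuous map $T\colon X\to X$ ($X$ not assumed compact). $\mathcal{M}(X)$ is the space of Borel probability measures on $X$ with the weak$^*$ topology (convergence of integrals of bounded continuous functions); $\mathcal{M}_T(X)$ is the subspace of $T$-invariant measures. For $x\in X$, $n\ge1$, $\mathcal{E}(x,n)=\frac1n\sum_{j=0}^{n-1}\delta_{T^j(x)}$. $V(x)$ is the set of limit points (limits of convergent subsequences) in $\mathcal{M}(X)$ of $(\mathcal{E}(x,n))_n$. For $V\subseteq\mathcal{M}_T(X)$: $G_V=\{x: V(x)\subseteq V\}$, $G(V)=\{x:V(x)=V\}$, ${}^{V}G=\{x:V(x)\cap V\ne\emptyset\}$. Specification property: for every $\varepsilon>0$ there is an integer $N_\varepsilon\ge0$ such that for each $k\ge1$ and all $\langle x_1,n_1\rangle,\dots,\langle x_k,n_k\rangle$ with $x_j\in X$, $n_j\ge1$, there are a point $y\in X$ and integers $0\le s_1,\dots,s_{k-1}\le N_\varepsilon$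 such that for every $1\le j\le k$ and $0\le t<n_j$, $\rho\big(T^{\sum_{i=1}^{j-1}(n_i+s_i)+t}(y),T^t(x_j)\big)<\varepsilon$. $\boldsymbol{\Sigma}^1_1$ (analytic) sets are continuous images of Borel sets between Polish spaces; $\boldsymbol{\Pi}^1_1$ (co-analytic) sets are their complements. For $\boldsymbol{\Gamma}\in\{\boldsymbol{\Sigma}^1_1,\boldsymbol{\Pi}^1_1\}$, a subset $A$ of a Polish space $X$ is $\boldsymbol{\Gamma}$-complete if $A\in\boldsymbol{\Gamma}$ and for every zero-dimensional Polish space $Y$ and every $B\subseteq Y$ in $\boldsymbol{\Gamma}$ there is a continuous $f\colon Y\to X$ with $B=f^{-1}(A)$. *)

(* Defs.v *)
From HB Require Import structures.
From mathcomp Require Import all_boot all_order all_algebra.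
From mathcomp Require Import all_classical all_reals all_analysis.

Set Implicit Arguments.
Unset Strict Implicit.
Unset Printing Implicit Defensive.

Import Order.TTheory GRing.Theory Num.Theory.
Import numFieldNormedType.Exports.

Local Open Scope classical_set_scope.
Local Open Scope ring_scope.

Section polish_spaces.
Variables (R : realType) (X : topologicalType).

Definition is_metric (d : X -> X -> R) :=
  [/\ forall x y, 0 <= d x y,
      forall x y, d x y = 0 <-> x = y,
      forall x y, d x y = d y x
    & forall x y z, d x z <= d x y + d y z].

Definition compatible_metric (d : X -> X -> R) :=
  forall x (A : set X),
    nbhs x A <-> exists2 e, 0 < e & [set y | d x y < e] `<=` A.

Definition cauchy_seq_for (d : X -> X -> R) (u : nat -> X) :=
  forall e, 0 < e ->
    exists N, forall m n, (N <= m)%N -> (N <= n)%N -> d (u m) (u n) < e.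

Definition complete_metric (d : X -> X -> R) :=
  forall u, cauchy_seq_for d u -> exists l : X, u @ \oo --> l.

Definition separable_space := exists2 D : set X, countable D & dense D.

Definition polish_metric (d : X -> X -> R) :=
  [/\ is_metric d, compatible_metric d & complete_metric d].

Definition polish := separable_space /\ exists d, polish_metric d.

(* The library's [zero_dimensional] only asks that points be separated by clopen
   sets, which is weaker than having a base of clopen sets. *)
Definition clopen_base :=
  forall (x : X) (A : set X), nbhs x A ->
    exists U : set X, [/\ clopen U, U x & U `<=` A].

End polish_spaces.

Section projective_classes.
Variable R : realType.

Definition analytic (X : topologicalType) (A : set X) :=
  exists (Z : topologicalType) (B : set Z) (f : Z -> X),
    [/\ polish R Z, <<s @open Z >> B, continuous f & A = f @` B].

Definition coanalytic (X : topologicalType) (A : set X) := analytic (~` A).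

Definition class_complete (Gamma : forall X : topologicalType, set X -> Prop)
    (X : topologicalType) (A : set X) :=
  Gamma X A /\
  forall Y : topologicalType, polish R Y -> clopen_base Y ->
  forall B : set Y, Gamma Y B ->
  exists2 f : Y -> X, continuous f & B = f @^-1` A.

Definition analytic_complete (X : topologicalType) (A : set X) :=
  class_complete analytic A.

Definition coanalytic_complete (X : topologicalType) (A : set X) :=
  class_complete coanalytic A.

End projective_classes.

Notation borel X := (g_sigma_algebraType (@open X)).

Section probability_measures.
Variables (R : realType) (X : ptopologicalType).
Local Open Scope ereal_scope.

(* Library measures are functions on all sets, unconstrained off the sigma-algebra.
   Forcing the value 0 there makes Leibniz equality coincide with equality of
   measures on Borel sets, so that singletons have their usual meaning. *)
Record prob_measure := ProbMeasure {
  prob_val :> probability (borel X) R;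
  prob_val_off : forall A : set (borel X), ~ measurable A -> prob_val A = 0 }.

HB.instance Definition _ := gen_eqMixin prob_measure.
HB.instance Definition _ := gen_choiceMixin prob_measure.

Lemma prob_measure_ext (mu nu : prob_measure) :
  (forall A : set (borel X), measurable A -> mu A = nu A) -> mu = nu.
Proof.
case: mu nu => [mu mu0] [nu nu0] /= mn.
have e : (mu : set (borel X) -> \bar R) = nu.
  apply/funext => A; case: (pselect (measurable A)) => mA; first exact: mn.
  by rewrite mu0// nu0.
have {}e : mu = nu.
  case: mu nu {mu0 nu0 mn} e => [m cm] [n cn] /= e.
  subst n; congr Probability.Pack.
  case: cm cn => [[p1 p2] [p3] [p4] [p5] [p6] [p7] [p8]].
  case=> [[q1 q2] [q3] [q4] [q5] [q6] [q7] [q8]].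
  rewrite (Prop_irrelevance p1 q1) (Prop_irrelevance p2 q2).
  rewrite (Prop_irrelevance p3 q3) (Prop_irrelevance p4 q4).
  rewrite (Prop_irrelevance p5 q5) (Prop_irrelevance p6 q6).
  by rewrite (Prop_irrelevance p7 q7) (Prop_irrelevance p8 q8).
subst nu; congr ProbMeasure; exact: Prop_irrelevance.
Qed.

Section borel_part.
Variable P : probability (borel X) R.

Definition borel_part (A : set (borel X)) : \bar R :=
  if `[< measurable A >] then P A else 0.

Lemma borel_partE (A : set (borel X)) : measurable A -> borel_part A = P A.
Proof. by move=> mA; rewrite /borel_part; case: asboolP. Qed.

Let borel_part0 : borel_part set0 = 0.
Proof. by rewrite borel_partE. Qed.

Let borel_part_ge0 A : 0 <= borel_part A.
Proof. by rewrite /borel_part; case: ifP. Qed.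

Let borel_part_sigma_additive : semi_sigma_additive borel_part.
Proof.
move=> F mF tF mUF; rewrite borel_partE//.
under eq_fun do under eq_bigr do rewrite borel_partE//.
exact: measure_semi_sigma_additive.
Qed.

HB.instance Definition _ := isMeasure.Build _ _ _ borel_part
  borel_part0 borel_part_ge0 borel_part_sigma_additive.

Let borel_partT : borel_part [set: borel X] = 1.
Proof. by rewrite borel_partE// probability_setT. Qed.

HB.instance Definition _ :=
  Measure_isProbability.Build _ _ _ borel_part borel_partT.

Let borel_part_off (A : set (borel X)) : ~ measurable A -> borel_part A = 0.
Proof. by move=> mA; rewrite /borel_part; case: asboolP. Qed.

Definition to_prob_measure : prob_measure := ProbMeasure borel_part_off.

End borel_part.

End probability_measures.

Section weak_topology.
Variables (R : realType) (X : ptopologicalType).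

Definition Cb :=
  {f : X -> R | continuous f /\ exists M, forall x, `|f x| <= M}.

Definition integrals (mu : prob_measure R X) : prod_topology (fun _ : Cb => R) :=
  fun f => \int[mu]_x sval f x.

HB.instance Definition _ :=
  Topological.copy (prob_measure R X) (initial_topology integrals).

End weak_topology.

Lemma weak_cvgP (R : realType) (X : ptopologicalType)
   (u : nat -> prob_measure R X) (mu : prob_measure R X) :
  u @ \oo --> mu <->
  forall f : Cb R X, (fun n => \int[u n]_x sval f x) @ \oo --> (\int[mu]_x sval f x : R).
Proof.
have c1 : continuous (@integrals R X : prob_measure R X -> prod_topology (fun _ : Cb R X => R)).
  exact: initial_continuous.
split=> [h f|h].
  have := continuous_cvg _ (c1 mu) h.
  have FF : Filter ((@integrals R X \o u) @ \oo) by apply: fmap_filter.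
  move=> /(_ _) H0; have {H0} H0 := H0 _.
  have /cvg_sup/(_ f) H := H0; move=> A.
  move=> nA; apply: (H ((fun g : Cb R X -> R => g f) @^-1` A)).
  exact: (@initial_continuous _ _ (fun g : Cb R X -> R => g f) (integrals mu) A nA).
have hp : (fun n => @integrals R X (u n)) @ \oo --> (@integrals R X mu : prod_topology (fun _ : Cb R X => R)).
  apply/cvg_sup => f.
  move=> A; rewrite nbhsE => -[B [[C oC CB] Bmu] BA].
  have : nbhs (\int[mu]_x sval f x : R) C.
    by apply: open_nbhs_nbhs; split=> //; move: Bmu; rewrite -CB.
  by move=> /(h f) hC; apply: (@filterS _ \oo _ ((fun n => \int[u n]_x sval f x) @^-1` C)) hC => n Cn; apply: BA; rewrite -CB.
move=> A; rewrite nbhsE => -[B [[C oC CB] Bmu] BA].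
have : nbhs (@integrals R X mu : prod_topology (fun _ : Cb R X => R)) C.
  by apply: open_nbhs_nbhs; split=> //; move: Bmu; rewrite -CB.
by move=> /hp hC; apply: (@filterS _ \oo _ ((fun n => @integrals R X (u n)) @^-1` C)) hC => n Cn; apply: BA; rewrite -CB.
Qed.

Section empirical_measures.
Variables (R : realType) (X : ptopologicalType) (T : X -> X).

Definition orbit_average (x : X) (n : nat) : set (borel X) -> \bar R :=
  mscale (n.+1%:R^-1)%:nng (msum (fun j => \d_(iter j T x : borel X)) n.+1).

HB.instance Definition _ x n := Measure.on (orbit_average x n).

Let orbit_averageT x n : orbit_average x n [set: borel X] = 1%E.
Proof.
rewrite /orbit_average /mscale /= /msum.
under eq_bigr do rewrite /= diracT.
by rewrite sumEFin -EFinM sumr_const card_ord mulVf// pnatr_eq0.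
Qed.

HB.instance Definition _ x n :=
  Measure_isProbability.Build _ _ _ (orbit_average x n) (orbit_averageT x n).

(* [empirical x n] averages over the n + 1 points x, ..., T^n x. *)
Definition empirical (x : X) (n : nat) : prob_measure R X :=
  to_prob_measure (orbit_average x n).

Lemma empiricalE x n (A : set (borel X)) : measurable A ->
  empirical x n A = (n.+1%:R^-1 * \sum_(j < n.+1) \1_A (iter j T x))%:E.
Proof.
by move=> mA; rewrite /= borel_partE// /orbit_average /mscale /= /msum EFinM -sumEFin.
Qed.

End empirical_measures.

Section generic_points.
Variables (R : realType) (X : ptopologicalType) (T : X -> X).

Definition invariant_measures : set (prob_measure R X) :=
  [set mu | forall A : set (borel X), measurable A -> mu (T @^-1` A) = mu A].

Definition limit_measures (x : X) : set (prob_measure R X) :=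
  [set mu | exists2 phi : nat -> nat, {homo phi : m n / (m < n)%N} &
    (fun n => empirical R T x (phi n)) @ \oo --> mu].

Definition G_sub (V : set (prob_measure R X)) : set X :=
  [set x | limit_measures x `<=` V].

Definition G_eq (V : set (prob_measure R X)) : set X :=
  [set x | limit_measures x = V].

Definition G_meet (V : set (prob_measure R X)) : set X :=
  [set x | limit_measures x `&` V !=set0].

End generic_points.

Section dynamical_systems.
Variables (R : realType) (X : ptopologicalType).

Definition polish_dynamical_system (rho : X -> X -> R) (T : X -> X) :=
  [/\ separable_space X, polish_metric rho & continuous T].

(* Orbit segments and gaps are indexed from 0; only the values [x j], [n j] for
   j < k and [s i] for i + 1 < k matter. *)
Definition specification (rho : X -> X -> R) (T : X -> X) :=
  forall eps, 0 < eps ->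
  exists N : nat, forall (k : nat) (x : nat -> X) (n : nat -> nat),
    (1 <= k)%N -> (forall j, (j < k)%N -> (1 <= n j)%N) ->
    exists (y : X) (s : nat -> nat),
      (forall i, (i.+1 < k)%N -> (s i <= N)%N) /\
      forall j t, (j < k)%N -> (t < n j)%N ->
        rho (iter (\sum_(i < j) (n i + s i) + t)%N T y) (iter t T (x j)) < eps.

End dynamical_systems.

(* Main.v *)
(** The system is a copy of the full shift over the alphabet N^N: writing
    m + 1 = 2^a (2 l + 1), a point of Baire space becomes a sequence of rows in
    N^N and [shift] deletes the first row.  Specification holds because orbit
    segments can be concatenated freely.  The measure is the point mass at the
    zero sequence.

    Upper bounds.  A sequence of probability measures on Baire space converges
    weakly iff the masses of all cylinders converge and no mass escapes from a
    cylinder to infinity through its children.  Hence "some subsequence of the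
    empirical measures of x converges to a measure other than mu" is a Borel
    condition on x and the subsequence.

    Hardness.  An analytic subset B of a zero-dimensional Polish space is
    { y : S_y has an infinite branch } for trees S_y depending on y in a clopen
    way.  The point attached to y alternates longer and longer blocks of zero
    rows with longer and longer blocks that repeat one row g_n, where g_n starts
    with the n-th finite sequence when that sequence is in S_y and is constantly
    n elsewhere.  The zero blocks put mu among the limits.  A branch yields the
    point mass at the corresponding constant sequence of rows; conversely any
    other limit has a nonzero point in its support, and a nonzero row of it is a
    limit of rows g_n, hence a branch of S_y. *)
From HB Require Import structures.
Require Import Defs.
From mathcomp Require Import all_boot all_order all_algebra.
From mathcomp Require Import all_classical all_reals all_analysis.
From mathcomp Require Import measurable_realfun lra zify.

Set Implicit Arguments.
Unset Strict Implicit.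
Unset Printing Implicit Defensive.

Import Order.TTheory GRing.Theory Num.Theory.
Import numFieldNormedType.Exports.

Local Open Scope classical_set_scope.
Local Open Scope ring_scope.

(** * Small reciprocals and clopen sets *)

Lemma invS_lt (R : realType) (e : R) : 0 < e -> exists n : nat, n.+1%:R^-1 < e.
Proof.
move=> e0; have [n _ /(_ n (leqnn n))] := near_infty_natSinv_lt (PosNum e0).
by exists n.
Qed.

Lemma clopen_near (X : topologicalType) (A : set X) (x : X) :
  clopen A -> \forall y \near x, A y = A x.
Proof.
move=> [oA cA]; have [Ax|nAx] := pselect (A x).
  have : nbhs x A by exact: open_nbhs_nbhs.
  by apply: filterS => y Ay; apply/propext; split.
have : nbhs x (~` A) by apply: open_nbhs_nbhs; split => //; rewrite openC.
by apply: filterS => y Ay; apply/propext; split.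
Qed.

(** * Baire space *)

Definition baire : Type := nat -> nat.

HB.instance Definition _ := gen_eqMixin baire.
HB.instance Definition _ := gen_choiceMixin baire.
HB.instance Definition _ := isPointed.Build baire (fun=> 0%N).

Definition agree (k : nat) (x y : baire) := forall i, (i < k)%N -> x i = y i.

Lemma agree_sym k x y : agree k x y -> agree k y x.
Proof. by move=> h i /h. Qed.

Lemma agree_trans k x y z : agree k x y -> agree k y z -> agree k x z.
Proof. by move=> xy yz i ik; rewrite xy// yz. Qed.

Lemma agreeW j k x y : (j <= k)%N -> agree k x y -> agree j x y.
Proof. by move=> jk h i ij; apply: h; apply: leq_trans jk. Qed.

(** The product topology of countably many discrete copies of the natural numbers, given by its
    basic neighbourhoods. *)
HB.instance Definition _ := hasNbhs.Build baire
  (fun x => [set A | exists k, [set y | agree k x y] `<=` A]).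

Section baire_topology.

Let nbhs_baire_filter (x : baire) : ProperFilter (nbhs x).
Proof.
apply: Build_ProperFilter_ex.
  by move=> A [k kA]; exists x; exact: kA.
split; first by exists 0%N.
  move=> A B [j jA] [k kB]; exists (maxn j k) => y /= xy; split.
    by apply: jA; apply: agreeW xy; exact: leq_maxl.
  by apply: kB; apply: agreeW xy; exact: leq_maxr.
by move=> A B AB [k kA]; exists k => y /kA /AB.
Qed.

Let nbhs_baire_singleton (x : baire) A : nbhs x A -> A x.
Proof. by case=> k; exact. Qed.

Let nbhs_baire_nbhs (x : baire) (A : set baire) : nbhs x A -> nbhs x (nbhs^~ A).
Proof.
case=> k kA; exists k => y xy; exists k => z yz; apply: kA.
exact: agree_trans xy yz.
Qed.

HB.instance Definition _ := Nbhs_isNbhsTopological.Build baire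
  nbhs_baire_filter nbhs_baire_singleton nbhs_baire_nbhs.

End baire_topology.

Section baire_metric.
Variable R : realType.

Definition rho (x y : baire) : R :=
  if pselect (exists n, x n != y n) is left h then (ex_minn h).+1%:R^-1 else 0.

Lemma rho_ge0 x y : 0 <= rho x y.
Proof. by rewrite /rho; case: pselect => // h; rewrite invr_ge0. Qed.

Lemma rho_ge x y d : x d <> y d -> d.+1%:R^-1 <= rho x y.
Proof.
move=> xyd; rewrite /rho; case: pselect => [h|[]]; last by exists d; apply/eqP.
case: ex_minnP => m _ /(_ d) md.
by rewrite lef_pV2 ?posrE ?ltr0n// ler_nat ltnS md//; apply/eqP.
Qed.

Lemma agree_rho k x y : agree k x y <-> rho x y <= k.+1%:R^-1.
Proof.
split=> [xy|xy i ik].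
  rewrite /rho; case: pselect => [h|_]; last by rewrite invr_ge0.
  case: ex_minnP => m xym _.
  rewrite lef_pV2 ?posrE ?ltr0n// ler_nat ltnS leqNgt; apply/negP => /xy.
  exact/eqP.
apply: contrapT => /rho_ge /le_trans /(_ xy).
by rewrite lef_pV2 ?posrE ?ltr0n// ler_nat ltnS leqNgt ik.
Qed.

Lemma agree_rho_lt k x y : rho x y < k.+1%:R^-1 -> agree k x y.
Proof. by move=> /ltW /agree_rho. Qed.

Lemma is_metric_rho : is_metric rho.
Proof.
split; first exact: rho_ge0.
- move=> x y; split=> [xy|->].
    apply/funext => i; apply: (_ : agree i.+1 x y) => //; apply/agree_rho.
    by rewrite xy invr_ge0.
  rewrite /rho; case: pselect => // h; exfalso.
  by case: h => n; rewrite eqxx.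
- move=> x y; apply/le_anti/andP; split.
    rewrite {1}/rho; case: pselect => [h|_]; last exact: rho_ge0.
    by case: ex_minnP => m /eqP xym _; apply: rho_ge => /esym.
  rewrite {1}/rho; case: pselect => [h|_]; last exact: rho_ge0.
  by case: ex_minnP => m /eqP xym _; apply: rho_ge => /esym.
- move=> x y z; rewrite {1}/rho; case: pselect => [h|_]; last first.
    by rewrite addr_ge0// rho_ge0.
  case: ex_minnP => m /eqP xzm _.
  case: (eqVneq (x m) (y m)) => [xym|/eqP xym].
    rewrite -[leLHS]add0r lerD ?rho_ge0//.
    by apply: rho_ge; rewrite -xym.
  by rewrite -[leLHS]addr0 lerD ?rho_ge0//; exact: rho_ge.
Qed.

Lemma compatible_rho : compatible_metric rho.
Proof.
move=> x A; split=> [[k kA]|[e e0 eA]].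
  exists k.+1%:R^-1; first by rewrite invr_gt0.
  by move=> y /= /agree_rho_lt; exact: kA.
have [k ke] := invS_lt e0; exists k => y /= /agree_rho xy.
by apply: eA => /=; apply: le_lt_trans ke.
Qed.

Lemma baire_cvgP (u : nat -> baire) (l : baire) :
  u @ \oo --> l <-> forall k, \forall n \near \oo, agree k l (u n).
Proof.
split=> [ul k|h A [k kA]]; first by apply: ul; exists k.
by apply: filterS (h k) => n; exact: kA.
Qed.

Lemma complete_rho : complete_metric rho.
Proof.
move=> u cu.
have /choice [N NP] k : exists N, forall m n, (N <= m)%N -> (N <= n)%N ->
    agree k (u m) (u n).
  have [|N NP] := cu k.+1%:R^-1; first by rewrite invr_gt0.
  by exists N => m n Nm Nn; apply: agree_rho_lt; exact: NP.
(* From index [N i.+1] on, the first i + 1 coordinates no longer change, so coordinate i of the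
   limit is read there. *)
exists (fun i => u (N i.+1) i); apply/baire_cvgP => k.
apply: filterS (nbhs_infty_ge (\max_(j < k) N j.+1)) => n nN i ik.
apply: (NP i.+1) => //; apply: leq_trans nN.
exact: (leq_bigmax (Ordinal ik)).
Qed.

Lemma separable_baire : separable_space baire.
Proof.
exists (range (fun s : seq nat => nth 0%N s : baire)).
  apply: (sub_countable _ (countableP [set: seq nat])).
  exact: card_image_le.
move=> O [x Ox] oO; have [k kO] : nbhs x O by exact: open_nbhs_nbhs.
exists (nth 0%N (mkseq x k)); split; last by exists (mkseq x k).
by apply: kO => i ik; rewrite nth_mkseq.
Qed.

Lemma polish_baire : polish R baire.
Proof.
split; first exact: separable_baire.
by exists rho; split; [exact: is_metric_rho|exact: compatible_rho|
                       exact: complete_rho].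
Qed.

End baire_metric.

(** * The row shift *)

(* Writing m + 1 = 2^a (2 l + 1) identifies a point of Baire space with the
   sequence of its rows: the entry l of row a sits at coordinate m.  Under this
   identification [shift] deletes the row 0. *)
Definition row_index (m : nat) : nat := logn 2 m.+1.
Definition col_index (m : nat) : nat := (m.+1 %/ 2 ^ row_index m)./2.
Definition coord (a l : nat) : nat := (2 ^ a * l.*2.+1).-1.

Lemma coordS a l : (coord a l).+1 = (2 ^ a * l.*2.+1)%N.
Proof. by rewrite /coord prednK// muln_gt0 expn_gt0. Qed.

Lemma row_coord a l : row_index (coord a l) = a.
Proof.
rewrite /row_index coordS lognM ?expn_gt0// pfactorK// -[RHS]addn0; congr addn.
by rewrite lognE /= dvdn2 /= odd_double.
Qed.

Lemma col_coord a l : col_index (coord a l) = l.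
Proof.
by rewrite /col_index row_coord coordS mulKn ?expn_gt0// -[l.*2.+1]/(true + l.*2)%N half_bit_double.
Qed.

Lemma coordK m : coord (row_index m) (col_index m) = m.
Proof.
apply: succn_inj; rewrite coordS /col_index /row_index.
have [q cq mq] := pfactor_coprime (isT : prime 2) (ltn0Sn m).
rewrite {2}mq mulnK ?expn_gt0//.
have oq : odd q by rewrite -coprime2n.
rewrite [RHS]mq mulnC; congr muln.
by rewrite -[RHS]odd_double_half oq.
Qed.

Lemma row_index_le m : (row_index m <= m)%N.
Proof. by rewrite -ltnS /row_index ltn_logl. Qed.

Lemma col_index_le m : (col_index m <= m)%N.
Proof.
rewrite -{2}[m]coordK -ltnS coordS.
apply: (@leq_trans (col_index m).*2.+1); first by rewrite ltnS -addnn leq_addr.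
by rewrite leq_pmull// expn_gt0.
Qed.

(** Since (2m + 1) + 1 = 2 (m + 1), coordinate 2m + 1 lies in the same column as coordinate m, one
    row further. *)
Definition shift (x : baire) : baire := fun m => x m.*2.+1.

Lemma row_double m : row_index m.*2.+1 = (row_index m).+1.
Proof.
by rewrite /row_index -doubleS -muln2 lognM// addn1.
Qed.

Lemma col_double m : col_index m.*2.+1 = col_index m.
Proof.
rewrite /col_index row_double -doubleS -muln2 expnSr divnMr//.
Qed.

Definition of_rows (e : nat -> nat -> nat) : baire :=
  fun m => e (row_index m) (col_index m).

Lemma shift_of_rows e : shift (of_rows e) = of_rows (fun i => e i.+1).
Proof.
by apply/funext => m; rewrite /shift /of_rows row_double col_double.
Qed.

Lemma iter_shift_of_rows n e :
  iter n shift (of_rows e) = of_rows (fun i => e (n + i)%N).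
Proof.
elim: n e => // n ih e; rewrite iterS ih shift_of_rows; congr of_rows.
by apply/funext => i; rewrite addSnnS.
Qed.

Lemma of_rowsK x : of_rows (fun a l => x (coord a l)) = x.
Proof. by apply/funext => m; rewrite /of_rows coordK. Qed.

Lemma agree_shift k x y : agree k.*2.+1 x y -> agree k (shift x) (shift y).
Proof. by move=> xy i ik; apply: xy; rewrite ltnS ltn_double. Qed.

Lemma continuous_shift : continuous shift.
Proof.
move=> x A [k kA]; exists k.*2.+1 => y /agree_shift xy; exact: kA.
Qed.

Lemma polish_dynamical_system_shift (R : realType) :
  polish_dynamical_system (@rho R) shift.
Proof.
split; [exact: separable_baire| |exact: continuous_shift].
by split; [exact: is_metric_rho|exact: compatible_rho|exact: complete_rho].
Qed.

Definition splice (L : nat) (x z : baire) : baire :=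
  of_rows (fun a l => if (a < L)%N then x (coord a l) else z (coord (a - L) l)).

Lemma iter_shift_splice L x z : iter L shift (splice L x z) = z.
Proof.
rewrite iter_shift_of_rows -[RHS]of_rowsK; congr of_rows.
by apply/funext => a; apply/funext => l; rewrite ltnNge leq_addr/= addKn.
Qed.

(** A coordinate i lies in a row of index at most i, so the first k coordinates at time t involve
    only rows below t + k. *)
Lemma agree_splice L k t x z : (t + k <= L)%N ->
  agree k (iter t shift (splice L x z)) (iter t shift x).
Proof.
move=> tkL i ik; rewrite -[in RHS](of_rowsK x) !iter_shift_of_rows /of_rows.
rewrite ifT//; apply: leq_trans tkL; rewrite ltn_add2l.
exact: leq_ltn_trans (row_index_le i) ik.
Qed.

Lemma specification_shift (R : realType) : specification (@rho R) shift.
Proof.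
move=> eps eps0; have [N Neps] := invS_lt eps0; exists N.
(* All gaps are equal to [N]: copying [n j + N] rows of [x j] keeps the first [N] coordinates right
   at every time t < [n j]. *)
suff H k (x : nat -> baire) n : exists y, forall j t, (j < k)%N -> (t < n j)%N ->
    agree N (iter (\sum_(i < j) (n i + N) + t)%N shift y) (iter t shift (x j)).
  move=> k x n _ _; have [y yP] := H k x n; exists y, (fun=> N); split=> // j t jk tn.
  by apply: le_lt_trans Neps; apply/agree_rho; exact: yP.
elim: k x n => [|k ih] x n; first by exists (fun=> 0%N).
have [y yP] := ih (fun i => x i.+1) (fun i => n i.+1).
exists (splice (n 0%N + N) (x 0%N) y) => -[|j] t.
  by move=> _ t0; rewrite big_ord0 add0n; apply: agree_splice; rewrite leq_add2r ltnW.
rewrite ltnS => jk tn; rewrite big_ord_recl -addnA addnC iterD iter_shift_splice.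
exact: yP.
Qed.

(** * Cylinders and weak convergence *)

Definition cyl (s : seq nat) : set baire := [set x : baire | mkseq x (size s) = s].

Lemma cylP s (x : baire) :
  cyl s x <-> forall i, (i < size s)%N -> x i = nth 0%N s i.
Proof.
split=> [h i ils|h]; first by rewrite -h nth_mkseq.
apply: (@eq_from_nth _ 0%N); rewrite size_mkseq// => i ils.
by rewrite nth_mkseq// h.
Qed.

Lemma cyl_mkseq (x y : baire) k : cyl (mkseq x k) y <-> agree k x y.
Proof.
split=> [/cylP h i ik|h].
  by have := h i; rewrite size_mkseq => ->//; rewrite nth_mkseq.
by apply/cylP => i; rewrite size_mkseq => ik; rewrite nth_mkseq// h.
Qed.

Lemma mem_cyl_mkseq (x : baire) k : cyl (mkseq x k) x.
Proof. exact/cyl_mkseq. Qed.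

Lemma cyl0 : cyl [::] = setT.
Proof. by rewrite -subTset => x _; rewrite /cyl. Qed.

Lemma cyl_agree s (x y : baire) : agree (size s) x y -> cyl s x -> cyl s y.
Proof. by move=> xy /cylP h; apply/cylP => i ils; rewrite -xy// h. Qed.

(** Two cylinders with a common point are nested, so the cylinders and the empty set form a
    pi-system. *)
Lemma cylI s t : cyl s `&` cyl t = set0 \/
  exists u, cyl s `&` cyl t = cyl u.
Proof.
have [/eqP->|/set0P[x [xs xt]]] := boolP (cyl s `&` cyl t == set0); first by left.
right; have [st|/ltnW ts] := leqP (size s) (size t).
  exists t; apply/seteqP; split=> [y []//|y yt]; split=> //.
  move/cylP : yt => yt; move/cylP : xt => xt.
  by apply: cyl_agree xs => i /leq_trans/(_ st) ils; rewrite xt// yt.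
exists s; apply/seteqP; split=> [y []//|y ys]; split=> //.
move/cylP : ys => ys; move/cylP : xs => xs.
by apply: cyl_agree xt => i /leq_trans/(_ ts) ils; rewrite xs// ys.
Qed.

Lemma clopen_agree (A : set baire) k :
  (forall x y, agree k x y -> A x -> A y) -> clopen A.
Proof.
move=> h; split.
  by rewrite openE => x Ax; exists k => y xy; exact: h Ax.
rewrite -openC openE => x Ax; exists k => y xy Ay; apply: Ax.
exact: h (agree_sym xy) Ay.
Qed.

Lemma clopen_cyl s : clopen (cyl s).
Proof. by apply: (@clopen_agree _ (size s)) => x y; exact: cyl_agree. Qed.

Lemma open_borel (X : ptopologicalType) (A : set X) :
  open A -> measurable (A : set (borel X)).
Proof. by move=> oA; exact: sub_sigma_algebra. Qed.

Lemma clopen_borel (X : ptopologicalType) (A : set X) :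
  clopen A -> measurable (A : set (borel X)).
Proof. by case=> /open_borel. Qed.

Lemma measurable_cyl s : measurable (cyl s : set (borel baire)).
Proof. exact: (@clopen_borel baire (cyl s) (clopen_cyl s)). Qed.

Lemma open_bigcup_cyl (A : set baire) :
  open A -> A = \bigcup_(s in [set s | cyl s `<=` A]) cyl s.
Proof.
move=> oA; apply/seteqP; split=> [x Ax|x [s /= sA sx]]; last exact: sA.
have [k kA] : nbhs x A by exact: open_nbhs_nbhs.
by exists (mkseq x k); [move=> y /= /cyl_mkseq; exact: kA|exact: mem_cyl_mkseq].
Qed.

(** An open set is a union of cylinders, and there are only countably many finite sequences. *)
Lemma open_measurable_cyl d (T : sigmaRingType d) (f : T -> baire) A :
  open A -> (forall s, measurable (f @^-1` cyl s)) -> measurable (f @^-1` A).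
Proof.
move=> oA mf.
have -> : f @^-1` A =
    \bigcup_(s : seq nat) (if `[< cyl s `<=` A >] then f @^-1` cyl s else set0).
  apply/seteqP; split=> [x|x [s _]].
    rewrite /preimage /= {1}(open_bigcup_cyl oA) => -[s sA xs].
    by exists s => //; case: asboolP.
  by case: asboolP => //= sA /sA.
apply: countable_bigcupT_measurable; first exact: countableP.
by move=> s; case: ifP.
Qed.

Lemma continuous_measurable_borel (R : realType) (X : ptopologicalType)
  (f : X -> R) : continuous f -> measurable_fun [set: borel X] f.
Proof.
move=> /continuousP cf; apply: (measurability _ (RGenOpens.measurableE R)).
move=> _ [_ [a [b ->] <-]]; rewrite setTI; apply: open_borel.
exact/cf/interval_open.
Qed.

(** * Masses of Borel sets as real numbers *)

Section prob_measure_facts.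
Variables (R : realType) (X : ptopologicalType).
Implicit Types (mu nu : prob_measure R X) (A B : set X).

Definition pr mu A : R := fine (mu A).

Lemma prE mu A : measurable (A : set (borel X)) -> mu A = (pr mu A)%:E.
Proof. by move=> mA; rewrite /pr fineK// fin_num_measure. Qed.

Lemma pr_ge0 mu A : 0 <= pr mu A.
Proof. by rewrite /pr fine_ge0. Qed.

Lemma prT mu : pr mu setT = 1.
Proof. by rewrite /pr probability_setT. Qed.

Lemma pr_le1 mu A : measurable (A : set (borel X)) -> pr mu A <= 1.
Proof. by move=> mA; rewrite -lee_fin -prE//; exact: probability_le1. Qed.

Lemma pr_le mu A B : measurable (A : set (borel X)) ->
  measurable (B : set (borel X)) -> A `<=` B -> pr mu A <= pr mu B.
Proof.
move=> mA mB AB; rewrite -lee_fin -!prE//; apply: le_measure => //; exact: mem_set.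
Qed.

Lemma prC mu A : measurable (A : set (borel X)) -> pr mu (~` A) = 1 - pr mu A.
Proof.
move=> mA; apply: EFin_inj; rewrite EFinB -!prE//; last exact: measurableC.
exact: probability_setC.
Qed.

Lemma clopen_indic_continuous A : clopen A -> continuous (\1_A : X -> R).
Proof.
move=> clA x; apply: cvg_near_cst; apply: filterS (clopen_near x clA) => y Ay.
by rewrite !indicE /in_mem /= /in_set Ay.
Qed.

Lemma Rintegral_indic mu A : measurable (A : set (borel X)) ->
  \int[mu]_x (\1_A x : R) = pr mu A.
Proof. by move=> mA; rewrite /Rintegral integral_indic// setIT. Qed.

Lemma integrable_Cb mu (f : X -> R) (M : R) : continuous f ->
  (forall x, `|f x| <= M) -> mu.-integrable [set: borel X] (EFin \o f).
Proof.
move=> cf fM; apply: measurable_bounded_integrable => //.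
- by apply: le_lt_trans (ltry 1); apply: probability_le1; exact: measurableT.
- exact: continuous_measurable_borel.
- exists M; split; first exact: num_real.
  by move=> N MN x _ /=; apply: le_trans (fM x) (ltW MN).
Qed.

(** The indicator of a clopen set is a bounded continuous function, so its integral is one of the
    coordinates that define the weak topology. *)
Lemma continuous_pr (A : set X) : clopen A ->
  continuous (fun nu : prob_measure R X => pr nu A).
Proof.
move=> clA nu.
have bA : continuous (\1_A : X -> R) /\ exists M : R, forall x, `|\1_A x : R| <= M.
  split; first exact: clopen_indic_continuous.
  by exists 1 => x; rewrite indicE; case: (_ \in _); rewrite ?normr1 ?normr0.
pose g : Cb R X := exist _ _ bA.
have -> : (fun nu : prob_measure R X => pr nu A) =
    (fun h : prod_topology (fun _ : Cb R X => R) => h g) \o @integrals R X.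
  apply/funext => m; rewrite /= /integrals /= Rintegral_indic//.
  exact: clopen_borel.
apply: continuous_comp; first exact: initial_continuous.
pose h : prod_topology (fun _ : Cb R X => R) := integrals nu.
have /cvg_sup/(_ g) H : h --> h by exact: cvg_id.
move=> B nB; apply: (H ((fun h : Cb R X -> R => h g) @^-1` B)).
exact: (@initial_continuous _ _ (fun h : Cb R X -> R => h g) h B nB).
Qed.

Lemma weak_cvg_clopen (u : nat -> prob_measure R X) mu A : clopen A ->
  u @ \oo --> mu -> pr (u n) A @[n --> \oo] --> pr mu A.
Proof. by move=> clA umu; exact: (cvg_comp _ _ umu (@continuous_pr A clA mu)). Qed.

End prob_measure_facts.

Lemma borel_cylE : @measurable _ (borel baire) = <<s set0 |` range cyl >>.
Proof.
apply/seteqP; split.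
  apply: smallest_sub; first exact: smallest_sigma_algebra.
  move=> A oA.
  apply: (@open_measurable_cyl _ (g_sigma_algebraType (set0 |` range cyl)) id) => //.
  by move=> s; apply: sub_sigma_algebra; right; exists s.
apply: smallest_sub; first exact: smallest_sigma_algebra.
by move=> _ [->|[s _ <-]]; [exact: measurable0|exact: measurable_cyl].
Qed.

(** Uniqueness of measures on a generating pi-system, here the cylinders together with the empty
    set. *)
Lemma prob_cyl_ext (R : realType) (mu nu : prob_measure R baire) :
  (forall s, pr mu (cyl s) = pr nu (cyl s)) -> mu = nu.
Proof.
move=> h; apply: prob_measure_ext => A mA.
apply: (@measure_unique _ R (borel baire) (set0 |` range cyl) (fun=> setT)
  borel_cylE _ _ _ mu nu) => //.
- move=> _ _ [->|[s _ <-]] [->|[t _ <-]]; rewrite ?set0I ?setI0; try by left.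
  by have [->|[u ->]] := cylI s t; [left|right; exists u].
- by move=> _; right; exists [::] => //; rewrite cyl0.
- by rewrite bigcup_const.
- move=> _ [->|[s _ <-]]; first by rewrite !measure0.
  have mC := measurable_cyl s.
  by apply: etrans (prE mu mC) _; rewrite h; exact/esym/(prE nu mC).
- by move=> _; apply: le_lt_trans (ltry 1); exact: (probability_le1 mu measurableT).
Qed.

(** * Weak convergence tested on cylinders *)

Section cylinder_convergence.
Variable R : realType.
Implicit Types (u : nat -> prob_measure R baire) (mu nu : prob_measure R baire).

Definition cyl_simple (g : baire -> R) :=
  exists r : seq (R * seq nat),
    forall x, g x = \sum_(p <- r) p.1 * \1_(cyl p.2) x.

Lemma cyl_simpleD f g : cyl_simple f -> cyl_simple g ->
  cyl_simple (fun x => f x + g x).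
Proof.
by move=> [r fr] [r' gr]; exists (r ++ r') => x; rewrite big_cat fr gr.
Qed.

Lemma cyl_simpleN f : cyl_simple f -> cyl_simple (fun x => - f x).
Proof.
move=> [r fr]; exists [seq (- p.1, p.2) | p <- r] => x.
by rewrite fr big_map -sumrN; apply: eq_bigr => p _ /=; rewrite mulNr.
Qed.

Lemma cyl_simple_indic c s : cyl_simple (fun x => c * \1_(cyl s) x).
Proof. by exists [:: (c, s)] => x; rewrite big_seq1. Qed.

Lemma cyl_simple0 : cyl_simple (fun=> 0).
Proof. by exists [::] => x; rewrite big_nil. Qed.

Lemma Rintegral_sum_indic mu (r : seq (R * seq nat)) :
  mu.-integrable [set: borel baire]
    (EFin \o (fun x => \sum_(p <- r) p.1 * \1_(cyl p.2) x)) /\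
  \int[mu]_x (\sum_(p <- r) p.1 * \1_(cyl p.2) x : R) =
    \sum_(p <- r) p.1 * pr mu (cyl p.2).
Proof.
elim: r => [|[c s] r [ih1 ih2]].
  have -> : (fun x => \sum_(p <- [::]) p.1 * \1_(cyl p.2) x) = cst 0 :> (baire -> R).
    by apply/funext => x; rewrite big_nil.
  split; first exact: finite_measure_integrable_cst.
  by rewrite big_nil Rintegral_cst// mul0r.
have is1 : mu.-integrable [set: borel baire] (EFin \o (\1_(cyl s) : baire -> R)).
  apply: (@integrable_Cb R baire mu _ 1).
    exact/clopen_indic_continuous/clopen_cyl.
  by move=> x; rewrite indicE; case: (_ \in _); rewrite ?normr1 ?normr0.
have is2 : mu.-integrable [set: borel baire]
    (EFin \o (fun x => c * (\1_(cyl s) x : R))).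
  exact: (integrableZl measurableT c is1).
have -> : (fun x => \sum_(p <- (c, s) :: r) p.1 * \1_(cyl p.2) x) =
    (fun x => c * \1_(cyl s) x + \sum_(p <- r) p.1 * \1_(cyl p.2) x) :> (baire -> R).
  by apply/funext => x; rewrite big_cons.
split; first exact: (integrableD measurableT is2 ih1).
rewrite RintegralD// ih2 big_cons RintegralZl// Rintegral_indic//.
exact: measurable_cyl.
Qed.

Lemma cyl_simple_integrable mu g :
  cyl_simple g -> mu.-integrable [set: borel baire] (EFin \o g).
Proof.
by move=> [r /funext ->]; have [] := Rintegral_sum_indic mu r.
Qed.

Lemma cyl_simple_cvg u mu g :
  (forall s, pr (u n) (cyl s) @[n --> \oo] --> pr mu (cyl s)) ->
  cyl_simple g ->
  (\int[u n]_x g x @[n --> \oo] --> (\int[mu]_x g x : R)).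
Proof.
move=> h [r /funext ->]; rewrite (Rintegral_sum_indic mu r).2.
under eq_fun do rewrite (Rintegral_sum_indic _ r).2.
by apply: (cvg_big (op := +%R)) => [|p _]; [exact: add_continuous|apply: cvgMr; exact: h].
Qed.

Section lower_approximation.
Variable f : baire -> R.
Hypotheses (cf : continuous f) (f0 : forall x, 0 <= f x).

Let c s := inf (f @` cyl s).

Let c_le s x : cyl s x -> c s <= f x.
Proof.
move=> sx; apply: ge_inf; last by exists x.
by exists 0 => _ [y _ <-].
Qed.

Let c_ge s a x : cyl s x -> (forall y, cyl s y -> a <= f y) -> a <= c s.
Proof.
move=> sx h; apply: lb_le_inf; first by exists (f x), x.
by move=> _ [y sy <-]; exact: h.
Qed.

(** At stage n this is the maximum of 0 and of the infima of [f] over those of the first n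
    cylinders, as enumerated by [CodeSeq.decode], that contain the point. *)
Fixpoint lower n : baire -> R :=
  if n is n'.+1 then
    let s := CodeSeq.decode n' in
    fun x => if `[< cyl s x >] then Num.max (lower n' x) (c s) else lower n' x
  else fun=> 0.

Lemma lower_ge0 n x : 0 <= lower n x.
Proof.
by elim: n => //= n ih; case: ifP => // _; rewrite le_max ih.
Qed.

Lemma lower_le n x : lower n x <= f x.
Proof.
by elim: n => //= n ih; case: asboolP => // sx; rewrite ge_max ih c_le.
Qed.

Lemma lower_nd x : nondecreasing_seq (lower ^~ x).
Proof.
apply/nondecreasing_seqP => n /=; case: ifP => // _.
by rewrite le_max lexx.
Qed.

Lemma lower_cvg x : lower n x @[n --> \oo] --> f x.
Proof.
apply/cvgrPdist_lt => e e0.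
(* On a small cylinder around x the values of [f] exceed [f x - e / 2]; its infimum there enters
   [lower n x] once n is larger than the code of that cylinder. *)
have [k kP] : nbhs x [set y | `|f x - f y| < e / 2].
  have /cvgrPdist_lt := @cf x; apply; rewrite divr_gt0//.
pose s := mkseq x k; have sx : cyl s x := mem_cyl_mkseq x k.
near=> n; have sn : (CodeSeq.code s < n)%N by near: n; exact: nbhs_infty_gt.
rewrite ger0_norm ?subr_ge0 ?lower_le//.
have : c s <= lower n x.
  apply: le_trans (lower_nd x sn) => /=; rewrite CodeSeq.codeK.
  by case: asboolP => // _; rewrite le_max lexx orbT.
have : f x - e / 2 <= c s.
  apply: (c_ge sx) => y /cyl_mkseq /kP /=; rewrite ltr_norml => /andP[_].
  by lra.
by lra.
Unshelve. all: by end_near. Qed.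

(* The factor [phi] makes the induction go through: a maximum with [c s] on
   [cyl s] is absorbed by changing [phi] on [cyl s `&` cyl t]. *)
Lemma lower_simple n (phi : R -> R) t :
  cyl_simple (fun x => phi (lower n x) * \1_(cyl t) x).
Proof.
elim: n phi t => [|n ih] phi t; first exact: (cyl_simple_indic (phi 0) t).
have [s es] : exists s, s = CodeSeq.decode n by eexists.
have key (psi : R -> R) :
    cyl_simple (fun x => psi (lower n x) * \1_(cyl s `&` cyl t) x).
  have [->|[w ->]] := cylI s t; last exact: ih.
  by under eq_fun do rewrite indic0 mulr0; exact: cyl_simple0.
have := cyl_simpleD (cyl_simpleD (ih phi t) (cyl_simpleN (key phi)))
  (key (fun a => phi (Num.max a (c s)))).
congr cyl_simple; apply/funext => x /=; rewrite -es !indicE in_setI.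
case: asboolP => sx.
  by rewrite (mem_set sx) /= subrr add0r.
by rewrite (memNset sx) /= !mulr0 subr0 addr0.
Qed.

End lower_approximation.

Lemma Rintegral_lower_cvg mu (f : baire -> R) (M : R) : continuous f ->
  (forall x, 0 <= f x) -> (forall x, f x <= M) ->
  \int[mu]_x lower f n x @[n --> \oo] --> (\int[mu]_x f x : R).
Proof.
move=> cf f0 fM.
have intf : mu.-integrable [set: borel baire] (EFin \o f).
  by apply: (@integrable_Cb R baire mu f M) => // x; rewrite ger0_norm.
have ls n : cyl_simple (lower f n).
  have := lower_simple f n id [::]; congr cyl_simple.
  by apply/funext => x; rewrite cyl0 indicT mulr1.
have intl n := cyl_simple_integrable mu (ls n).
apply: fine_cvg; rewrite fineK; last exact: integrable_fin_num.
have limE : (fun x => limn (EFin \o (lower f ^~ x))) = EFin \o f.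
  apply/funext => x /=; apply/cvg_lim => //; apply: cvg_EFin.
    by apply: nearW => n.
  exact: lower_cvg.
have -> : (\int[mu]_x (f x)%:E = \int[mu]_x (limn (EFin \o (lower f ^~ x))))%E.
  by rewrite limE.
apply: cvg_monotone_convergence => //.
- by move=> n; have /integrableP[] := intl n.
- by move=> n x _; rewrite lee_fin lower_ge0.
- by move=> x _ m n mn; rewrite lee_fin; exact: lower_nd.
Qed.

(** Some [lower f N] has almost the same integral as f under [mu]. Its integrals converge along u,
    as it is a finite combination of cylinders, and they bound those of f from below. *)
Lemma Rintegral_liminf u mu (f : baire -> R) (M : R) : continuous f ->
  (forall x, 0 <= f x) -> (forall x, f x <= M) ->
  (forall s, pr (u n) (cyl s) @[n --> \oo] --> pr mu (cyl s)) ->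
  forall e : R, 0 < e -> \forall n \near \oo,
    \int[mu]_x f x - e < \int[u n]_x f x :> R.
Proof.
move=> cf f0 fM h e e0.
have intf (nu : prob_measure R baire) : nu.-integrable [set: borel baire] (EFin \o f).
  by apply: (@integrable_Cb R baire nu f M) => // x; rewrite ger0_norm.
have e20 : 0 < e / 2 by rewrite divr_gt0.
have /cvgrPdist_lt/(_ _ e20) [N _ /(_ N (leqnn N)) /=] :=
  @Rintegral_lower_cvg mu f M cf f0 fM.
rewrite ltr_norml => /andP[_ Ne].
have ls : cyl_simple (lower f N).
  have := lower_simple f N id [::]; congr cyl_simple.
  by apply/funext => x; rewrite cyl0 indicT mulr1.
have /cvgrPdist_lt/(_ _ e20) := cyl_simple_cvg h ls.
apply: filterS => n; rewrite ltr_norml => /andP[_ ne].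
have : \int[u n]_x lower f N x <= \int[u n]_x f x :> R.
  apply: le_Rintegral => //.
  - exact: cyl_simple_integrable.
  - exact: intf.
  - by move=> x _; exact: lower_le.
by lra.
Qed.

(** If |f| is at most M, both M + f and M - f are nonnegative and bounded; the lower bound on their
    integrals gives the two inequalities for f. *)
Lemma weak_cvg_cyl u mu :
  (forall s, pr (u n) (cyl s) @[n --> \oo] --> pr mu (cyl s)) ->
  u @ \oo --> mu.
Proof.
move=> h; apply/weak_cvgP => -[f [cf [M fM]]] /=.
have intf (nu : prob_measure R baire) : nu.-integrable [set: borel baire] (EFin \o f).
  exact: (@integrable_Cb R baire nu f M).
have intM (nu : prob_measure R baire) :
    nu.-integrable [set: borel baire] (EFin \o cst M).
  exact: finite_measure_integrable_cst.
have RM (nu : prob_measure R baire) : \int[nu]_x (cst M x) = M :> R.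
  by rewrite Rintegral_cst// -/(pr nu setT) prT mulr1.
have RD (nu : prob_measure R baire) : \int[nu]_x (cst M x + f x) = M + \int[nu]_x f x :> R.
  by rewrite -[X in _ = X + _](RM nu); apply: RintegralD; [exact: measurableT|exact: intM|exact: intf].
have RB (nu : prob_measure R baire) : \int[nu]_x (cst M x - f x) = M - \int[nu]_x f x :> R.
  by rewrite -[X in _ = X - _](RM nu); apply: RintegralB; [exact: measurableT|exact: intM|exact: intf].
have fb x : - M <= f x <= M by rewrite -ler_norml.
apply/cvgrPdist_lt => e e0.
have h1 : \forall n \near \oo, \int[mu]_x (cst M x + f x) - e <
    \int[u n]_x (cst M x + f x) :> R.
  apply: (@Rintegral_liminf u mu _ (M + M)) => //.
  - by move=> x; exact: (cvgD (cvg_cst M) (@cf x)).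
  - by move=> x; have /andP[] := fb x; rewrite /=; lra.
  - by move=> x; have /andP[] := fb x; rewrite /=; lra.
have h2 : \forall n \near \oo, \int[mu]_x (cst M x - f x) - e <
    \int[u n]_x (cst M x - f x) :> R.
  apply: (@Rintegral_liminf u mu _ (M + M)) => //.
  - by move=> x; exact: (cvgB (cvg_cst M) (@cf x)).
  - by move=> x; have /andP[] := fb x; rewrite /=; lra.
  - by move=> x; have /andP[] := fb x; rewrite /=; lra.
move: h1 h2; rewrite RD RB; apply: filterS2 => n.
by rewrite RD RB ltr_norml => h1 h2; apply/andP; split; lra.
Qed.

End cylinder_convergence.

(** * Limits of empirical measures *)

Section image_measure.
Variables (R : realType) (d : measure_display) (T : measurableType d).
Variables (X : ptopologicalType) (m : {measure set T -> \bar R}).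
Variable f : T -> borel X.
Hypotheses (mf : measurable_fun [set: T] f) (m1 : m setT = 1%E).

Definition image_fun : set (borel X) -> \bar R := pushforward m f.

HB.instance Definition _ := Measure.copy image_fun
  (measure_function_pushforward__canonical__measure_function_Measure m mf).

Let image_funT : image_fun setT = 1%E.
Proof. by rewrite /image_fun /pushforward preimage_setT. Qed.

HB.instance Definition _ :=
  Measure_isProbability.Build _ _ _ image_fun image_funT.

Definition image_prob : prob_measure R X := to_prob_measure image_fun.

Lemma image_probE (A : set (borel X)) :
  measurable A -> image_prob A = m (f @^-1` A).
Proof. by move=> mA; rewrite /image_prob /= borel_partE. Qed.

End image_measure.

Section dirac_prob.
Variables (R : realType) (X : ptopologicalType).

Definition dirac_prob (z : X) : prob_measure R X := to_prob_measure (\d_(z : borel X)).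

Lemma pr_dirac z (A : set X) : measurable (A : set (borel X)) ->
  pr (dirac_prob z) A = \1_A z.
Proof. by move=> mA; rewrite /pr /= borel_partE//= diracE indicE. Qed.

End dirac_prob.

Section empirical_limits.
Variables (R : realType) (X : ptopologicalType) (T : X -> X).

Lemma pr_empirical x n (A : set X) : measurable (A : set (borel X)) ->
  pr (empirical R T x n) A = n.+1%:R^-1 * \sum_(j < n.+1) \1_A (iter j T x).
Proof. by move=> mA; rewrite /pr empiricalE. Qed.

(** The two sums run over the orbit with a shift by one, so all terms cancel except the first and
    the last. *)
Lemma pr_empirical_preimage x n (A : set X) : measurable (A : set (borel X)) ->
  measurable (T @^-1` A : set (borel X)) ->
  `|pr (empirical R T x n) (T @^-1` A) - pr (empirical R T x n) A| <=
    n.+1%:R^-1.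
Proof.
move=> mA mTA; rewrite !pr_empirical//.
rewrite -mulrBr normrM ger0_norm ?invr_ge0//.
rewrite -[leRHS]mulr1 ler_wpM2l ?invr_ge0//.
have -> : \sum_(j < n.+1) \1_(T @^-1` A) (iter j T x) =
    \sum_(j < n.+1) (\1_A (iter j.+1 T x) : R).
  by apply: eq_bigr => j _; rewrite !indicE iterS.
rewrite big_ord_recr [X in _ - X]big_ord_recl /=.
set S := \sum_(i < n) _; set a := \1_A _; set b := \1_A _.
have -> : S + a - (b + S) = a - b by lra.
have [a0 a1] : 0 <= a /\ a <= 1 by rewrite /a indicE ler0n lern1 leq_b1.
have [b0 b1] : 0 <= b /\ b <= 1 by rewrite /b indicE ler0n lern1 leq_b1.
by rewrite ler_norml; apply/andP; split; lra.
Qed.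

Lemma increasing_ge_id (phi : nat -> nat) :
  {homo phi : m n / (m < n)%N} -> forall n, (n <= phi n)%N.
Proof.
by move=> h; elim=> // n ih; apply: leq_ltn_trans ih _; exact: h.
Qed.

(** Under the n-th empirical measure the two masses differ by at most 1/(n + 1), and masses of
    clopen sets pass to the limit. *)
Lemma limit_measures_preimage x (nu : prob_measure R X) (A : set X) : continuous T -> clopen A ->
  limit_measures T x nu -> pr nu (T @^-1` A) = pr nu A.
Proof.
move=> cT clA [phi phi_inc phi_nu].
have clTA : clopen (T @^-1` A).
  by apply: clopen_comp => //.
have h1 := weak_cvg_clopen clA phi_nu.
have h2 := weak_cvg_clopen clTA phi_nu.
apply/eqP; rewrite -subr_eq0; apply/eqP.
have h3 := cvgB (FF := eventually_filter) h2 h1; rewrite -(cvg_lim (@Rhausdorff R) h3).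
apply/cvg_lim; first exact: Rhausdorff.
apply/cvgrPdist_lt => e e0; have [N Ne] := invS_lt e0.
near=> n; rewrite sub0r normrN.
apply: (le_lt_trans (pr_empirical_preimage _ _ (clopen_borel clA) (clopen_borel clTA))).
apply: le_lt_trans Ne; rewrite lef_pV2 ?posrE ?ltr0n// ler_nat ltnS.
apply: leq_trans (increasing_ge_id phi_inc n).
by near: n; exact: nbhs_infty_ge.
Unshelve. all: by end_near. Qed.

End empirical_limits.

(** The singleton is cut out by prescribing the mass of each cylinder, and each such mass is a
    continuous function of the measure. *)
Lemma closed_prob1 (R : realType) (mu : prob_measure R baire) :
  closed [set mu].
Proof.
have -> : [set mu] = \bigcap_(s in [set: seq nat])
    (fun nu : prob_measure R baire => pr nu (cyl s)) @^-1` [set pr mu (cyl s)].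
  apply/seteqP; split=> [_ -> //|nu h].
  by apply: prob_cyl_ext => s; exact: (h s).
apply: closed_bigI => s _; apply: closed_comp; last exact: closed_eq.
by move=> nu _; apply: continuous_pr; exact: clopen_cyl.
Qed.

Lemma measurable_shift :
  measurable_fun [set: borel baire] (shift : borel baire -> borel baire).
Proof.
apply: (measurability _ (erefl : @measurable _ (borel baire) = <<s @open baire >>)).
move=> _ [A oA <-]; rewrite setTI; apply: (@open_borel baire).
by apply: open_comp => // x _; exact: continuous_shift.
Qed.

Section shift_limits.
Variable R : realType.
Local Notation emp := (empirical R shift).

(** The limit and its image under [shift] agree on cylinders, which are clopen, hence on all Borel
    sets. *)
Lemma limit_measures_invariant x :
  limit_measures shift x `<=` @invariant_measures R baire shift.
Proof.
move=> nu xnu A mA.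
pose nu' := image_prob measurable_shift (probability_setT nu).
suff e : nu' = nu by rewrite -[in RHS]e image_probE.
apply: prob_cyl_ext => s; have mC := measurable_cyl s.
rewrite {1}/pr image_probE// -/(pr nu _).
apply: (limit_measures_preimage continuous_shift) xnu; exact: clopen_cyl.
Qed.

Definition zero : baire := fun=> 0%N.

Lemma invariant_dirac0 : @invariant_measures R baire shift (dirac_prob R zero).
Proof.
move=> A mA; have mTA : measurable (shift @^-1` A : set (borel baire)).
  by rewrite -[X in measurable X]setTI; exact: measurable_shift.
apply: etrans (prE _ mTA) _; apply: etrans (esym (prE _ mA)).
by rewrite !pr_dirac.
Qed.

(** This replaces the quantifier over subsequences by quantifiers over natural numbers. A
    subsequence is rebuilt by choosing ever later times for ever smaller cylinders around z. *)
Lemma limit_dirac x (z : baire) : limit_measures shift x (dirac_prob R z) <->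
  forall k N, exists2 n, (N <= n)%N &
    1 - k.+1%:R^-1 <= pr (emp x n) (cyl (mkseq z k)).
Proof.
split=> [[phi phi_inc xz] k N|h].
  have := weak_cvg_clopen (clopen_cyl (mkseq z k)) xz.
  rewrite pr_dirac; last exact: measurable_cyl.
  rewrite indicE mem_set /= ?mulr1n; last exact: mem_cyl_mkseq.
  have k0 : 0 < k.+1%:R^-1 :> R by rewrite invr_gt0.
  move=> /cvgrPdist_lt /(_ _ k0) [M _ MP].
  exists (phi (maxn M N)).
    by apply: leq_trans (increasing_ge_id phi_inc _); exact: leq_maxr.
  have := MP (maxn M N) (leq_maxl _ _); rewrite /= ltr_norml => /andP[_].
  by move=> /ltW; rewrite lerBlDr lerBlDl.
have /choice [g gP] (p : nat * nat) : exists n, (p.2 <= n)%N /\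
    1 - p.1.+1%:R^-1 <= pr (emp x n) (cyl (mkseq z p.1)).
  by have [n] := h p.1 p.2; exists n.
pose phi := fix phi k := if k is k'.+1 then g (k, (phi k').+1) else g (0, 0)%N.
have phi_inc : {homo phi : m n / (m < n)%N}.
  apply: homo_ltn; first exact: ltn_trans.
  by move=> k; have [] := gP (k.+1, (phi k).+1).
have phiP k : 1 - k.+1%:R^-1 <= pr (emp x (phi k)) (cyl (mkseq z k)).
  by case: k => [|k]; [have [] := gP (0, 0)%N|have [] := gP (k.+1, (phi k).+1)].
exists phi => //; apply: weak_cvg_cyl => s; have mC := measurable_cyl s.
rewrite pr_dirac//; apply/cvgrPdist_lt => e e0; have [N Ne] := invS_lt e0.
near=> k.
have sk : (size s <= k)%N by near: k; exact: nbhs_infty_ge.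
have mZ := measurable_cyl (mkseq z k).
have ke : k.+1%:R^-1 < e.
  apply: le_lt_trans Ne; rewrite lef_pV2 ?posrE ?ltr0n// ler_nat ltnS.
  by near: k; exact: nbhs_infty_ge.
have {ke} [q ke h1] : exists2 q : R, q < e & 1 - q <= pr (emp x (phi k)) (cyl (mkseq z k)).
  by exists k.+1%:R^-1.
rewrite indicE; have [sz|sz] := pselect (cyl s z).
  rewrite (mem_set sz) /= mulr1n; have := pr_le1 (emp x (phi k)) mC.
  have : pr (emp x (phi k)) (cyl (mkseq z k)) <= pr (emp x (phi k)) (cyl s).
    apply: pr_le => // y /cyl_mkseq zy; apply: cyl_agree sz; exact: agreeW zy.
  by rewrite ltr_norml => h2 h3; apply/andP; split; lra.
rewrite (memNset sz) /= mulr0n; have := pr_ge0 (emp x (phi k)) (cyl s).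
have : pr (emp x (phi k)) (cyl s) <= pr (emp x (phi k)) (~` cyl (mkseq z k)).
  apply: pr_le => //; first exact: (@measurableC _ (borel baire)).
  move=> y ys /cyl_mkseq zy; apply: sz; apply: cyl_agree ys.
  exact: agree_sym (agreeW sk zy).
by rewrite prC// ltr_norml => h2 h3; apply/andP; split; lra.
Unshelve. all: by end_near. Qed.

End shift_limits.

(** * Measures with prescribed values on cylinders *)

Lemma cyl_rcons s k (x : baire) : cyl (rcons s k) x <-> cyl s x /\ x (size s) = k.
Proof.
rewrite /cyl /= size_rcons mkseqS; split=> [/rcons_inj[]//|[-> ->]//].
Qed.

(* The cylinders are realized by nested half-open intervals of [0, 1), and the
   measure is the image of Lebesgue measure under the resulting coding map. *)
Section cylinder_measure.
Variables (R : realType) (p : seq nat -> R).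
Hypotheses (p_ge0 : forall s, 0 <= p s) (p_nil : p [::] = 1).
Hypothesis p_sum : forall s : seq nat,
  \sum_(i < k) p (rcons s i) @[k --> \oo] --> p s.

Let psum (s : seq nat) k := \sum_(i < k) p (rcons s i).

Let psumS s k : psum s k.+1 = psum s k + p (rcons s k).
Proof. by rewrite /psum big_ord_recr. Qed.

Let psum_nd s : nondecreasing_seq (psum s).
Proof. by apply/nondecreasing_seqP => k; rewrite psumS lerDl. Qed.

Let psum_le s k : psum s k <= p s.
Proof.
have h : cvgn (psum s) by apply/cvg_ex; exists (p s); exact: p_sum.
rewrite -(cvg_lim (@Rhausdorff R) (@p_sum s)).
exact: (nondecreasing_cvgn_le (psum_nd s) h k).
Qed.

(** The j-th term is the total mass of the siblings that precede the child chosen at level j, so the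
    interval of s starts after all of their intervals. *)
Let left_end s := \sum_(j < size s) psum (take j s) (nth 0%N s j).

Let left_end_rcons s k : left_end (rcons s k) = left_end s + psum s k.
Proof.
rewrite /left_end size_rcons big_ord_recr /=; congr (_ + _).
  apply: eq_bigr => -[j js] _ /=.
  by rewrite nth_rcons js -cats1 takel_cat// ltnW.
by rewrite nth_rcons ltnn eqxx -cats1 take_size_cat.
Qed.

Let itv s t := left_end s <= t < left_end s + p s.

Let itv_rcons s k t : itv (rcons s k) t =
  (psum s k <= t - left_end s < psum s k.+1).
Proof.
by rewrite /itv left_end_rcons psumS -addrA lerBrDl ltrBlDl.
Qed.

Let itv_nil t : itv [::] t = (0 <= t < 1).
Proof. by rewrite /itv /left_end big_ord0 p_nil add0r. Qed.

(** As [psum s] converges to [p s], the intervals of the children exhaust that of s; the least k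
    whose partial sum exceeds the offset of t ends the right child. *)
Let itv_split s t : itv s t -> exists k, itv (rcons s k) t.
Proof.
move=> /andP[st ts].
have ex : exists k, t - left_end s < psum s k.
  have d0 : 0 < p s - (t - left_end s) by rewrite subr_gt0 ltrBlDl.
  have /cvgrPdist_lt/(_ _ d0) [N _ /(_ N (leqnn N)) /=] := @p_sum s.
  by rewrite ltr_norml => /andP[_]; rewrite -/(psum s N) ltrD2l ltrN2; exists N.
case: (ex_minnP ex) => -[|k] tk kmin.
  by move: tk; rewrite /psum big_ord0 ltNge subr_ge0 st.
exists k; rewrite itv_rcons tk andbT leNgt; apply/negP => /kmin.
by rewrite ltnn.
Qed.

Let itv_sub s k t : itv (rcons s k) t -> itv s t.
Proof.
rewrite itv_rcons => /andP[h1 h2]; rewrite /itv -subr_ge0 -ltrBlDl.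
rewrite (le_trans _ h1) ?(lt_le_trans h2)// /psum.
by apply: sumr_ge0 => i _.
Qed.

Let itv_inj s k k' t : itv (rcons s k) t -> itv (rcons s k') t -> k = k'.
Proof.
wlog kk' : k k' / (k <= k')%N.
  move=> h tk tk'; have [kk'|/ltnW kk'] := leqP k k'; first exact: h.
  by apply/esym; exact: h.
rewrite !itv_rcons => /andP[_ h1] /andP[h2 _]; apply/eqP.
rewrite eqn_leq kk' leqNgt; apply/negP => lt.
by have := lt_le_trans h1 (le_trans (psum_nd s lt) h2); rewrite ltxx.
Qed.

Let child s t := xget 0%N [set k | itv (rcons s k) t].

Let node t := fix node n :=
  if n is n'.+1 then rcons (node n') (child (node n') t) else [::].

Let code t : baire := fun n => child (node t n) t.

Let mkseq_code t n : mkseq (code t) n = node t n.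
Proof. by elim: n => // n ih; rewrite mkseqS ih. Qed.

Let child_itv s k t : itv (rcons s k) t -> child s t = k.
Proof.
by move=> tk; apply: xget_unique => // k' /= tk'; exact: itv_inj tk' tk.
Qed.

Let cyl_code s t : 0 <= t < 1 -> cyl s (code t) <-> itv s t.
Proof.
move=> t01; elim/last_ind: s => [|s k ih].
  by rewrite cyl0 itv_nil t01.
rewrite cyl_rcons; split=> [[/[dup] sc /ih /itv_split[k' tk']]|tk].
  by rewrite /code -mkseq_code sc (child_itv tk') => <-.
have /ih sc := itv_sub tk; split=> //.
by rewrite /code -mkseq_code sc (child_itv tk).
Qed.

Let U : set R := `[0, 1[.

(** Points outside [0, 1) are sent to the default value [zero]; the measure used below gives them no
    mass. *)
Let coding (t : R) : borel baire := if t \in U then code t else zero.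

Let coding_cyl s : coding @^-1` cyl s `&` U = [set` `[left_end s, left_end s + p s[].
Proof.
apply/seteqP; split=> t /=.
  rewrite /coding => -[+ tU]; rewrite mem_set// => /cyl_code.
  by rewrite in_itv /=; apply; move: tU; rewrite /U /= in_itv.
rewrite in_itv /= -/(itv s t) => ts.
have tU : 0 <= t < 1.
  rewrite -itv_nil; elim/last_ind: s ts => // s k ih /itv_sub; exact: ih.
have tU' : U t by rewrite /U /= in_itv.
by split=> //; rewrite /coding mem_set//; apply/cyl_code.
Qed.

Let measurable_coding :
  measurable_fun [set: measurableTypeR R] (coding : measurableTypeR R -> borel baire).
Proof.
apply: (measurability _ (erefl : @measurable _ (borel baire) = <<s @open baire >>)).
move=> _ [A oA <-]; rewrite setTI; apply: open_measurable_cyl => // s.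
(* Inside [U] the preimage is an interval. Outside, [coding] is constant, so the preimage is all of
   the complement or empty. *)
rewrite -[X in measurable X](setUIDK _ U); apply: measurableU.
  by rewrite coding_cyl; exact: measurable_itv.
have [sz|sz] := pselect (cyl s zero).
  have -> : coding @^-1` cyl s `\` U = ~` U.
    apply/seteqP; split=> t /=; first by case.
    by move=> tU; split=> //; rewrite /coding memNset.
  by apply: measurableC; exact: measurable_itv.
have -> : coding @^-1` cyl s `\` U = set0.
  apply/seteqP; split=> t //= -[+ tU]; rewrite /coding memNset//.
exact: measurable0.
Qed.

Lemma cylinder_measure_exists :
  exists nu : prob_measure R baire, forall s, pr nu (cyl s) = p s.
Proof.
have mU : measurable U by exact: measurable_itv.
pose m := mrestr (@lebesgue_measure R) mU.
have m1 : m setT = 1%E.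
  by rewrite /m /mrestr setTI lebesgue_measure_itv /= lte_fin ltr01 sube0.
exists (image_prob measurable_coding m1) => s.
rewrite /pr image_probE; last exact: measurable_cyl.
transitivity (fine (lebesgue_measure (coding @^-1` cyl s `&` U))); first by [].
rewrite coding_cyl lebesgue_measure_itv /= lte_fin ltrDl.
have := p_ge0 s; rewrite le_eqVlt => /predU1P[<-|ps]; first by rewrite ltxx.
by rewrite ps /= addrAC subrr add0r.
Qed.

End cylinder_measure.

Lemma sum_pr_cyl_le (R : realType) (nu : prob_measure R baire) (s : seq nat) K :
  \sum_(i < K) pr nu (cyl (rcons s i)) <= pr nu (cyl s).
Proof.
have mC (i : nat) := measurable_cyl (rcons s i).
have e : pr nu (\big[setU/set0]_(i < K) cyl (rcons s i)) =
    \sum_(i < K) pr nu (cyl (rcons s i)).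
  apply: EFin_inj; rewrite -sumEFin -prE; last exact: bigsetU_measurable.
  rewrite measure_semi_additive_ord //=.
  - by apply: eq_bigr => i _; exact: prE.
  - apply/trivIsetP => i j _ _ ij; rewrite -subset0 => x [].
    move=> /cyl_rcons[_ xi] /cyl_rcons[_ xj]; move/eqP : ij; apply.
    by apply/val_inj; rewrite /= -xi -xj.
  - exact: bigsetU_measurable.
rewrite -e; apply: pr_le; [exact: bigsetU_measurable|exact: measurable_cyl|].
by rewrite -(bigcup_mkord K (fun i => cyl (rcons s i))) => x [i _ /cyl_rcons[]].
Qed.

(** The limits [p s] of the cylinder masses are the candidate measure. The second hypothesis is a
    tightness condition: no mass of s escapes to late children, so [p s] is the sum of [p] over all
    children of s. *)
Lemma limit_measure_exists (R : realType) (u : nat -> prob_measure R baire) :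
  (forall s, cvgn (fun n => pr (u n) (cyl s))) ->
  (forall (s : seq nat) (e : R), 0 < e -> exists K, \forall n \near \oo,
     pr (u n) (cyl s) - \sum_(i < K) pr (u n) (cyl (rcons s i)) < e) ->
  exists nu : prob_measure R baire, u @ \oo --> nu.
Proof.
move=> uc ut; pose p s := limn (fun n => pr (u n) (cyl s)).
have pP s : pr (u n) (cyl s) @[n --> \oo] --> p s := uc s.
have sumP (s : seq nat) K : \sum_(i < K) pr (u n) (cyl (rcons s i)) @[n --> \oo] -->
    \sum_(i < K) p (rcons s i).
  by apply: (cvg_big (op := +%R)) => [|i _]; [exact: add_continuous|exact: pP].
have p0 s : 0 <= p s.
  by apply: limr_ge (uc s) _; apply: nearW => n; exact: pr_ge0.
have [|s|nu nuP] := cylinder_measure_exists p0.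
- apply/cvg_lim; first exact: Rhausdorff.
  by rewrite cyl0; under eq_fun do rewrite prT; exact: cvg_cst.
- apply/cvgrPdist_lt => e e0; have e20 : 0 < e / 2 by rewrite divr_gt0.
  have [K KP] := ut s _ e20.
  have Ke : p s - \sum_(i < K) p (rcons s i) <= e / 2.
    have h := cvgB (FF := eventually_filter) (@pP s) (@sumP s K).
    apply: (ler_cvg_to h (cvg_cst (e / 2))).
    by apply: filterS KP => n; exact: ltW.
  near=> k.
  have Kk : (K <= k)%N by near: k; exact: nbhs_infty_ge.
  have h1 : \sum_(i < K) p (rcons s i) <= \sum_(i < k) p (rcons s i).
    rewrite -!(big_mkord xpredT (fun i => p (rcons s i))) (big_cat_nat (leq0n K) Kk) /=.
    by rewrite lerDl; apply: sumr_ge0 => i _.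
  have h2 : \sum_(i < k) p (rcons s i) <= p s.
    apply: (ler_cvg_to (@sumP s k) (@pP s)).
    by apply: nearW => n; exact: sum_pr_cyl_le.
  by rewrite ltr_norml; apply/andP; split; lra.
exists nu; apply: weak_cvg_cyl => s; rewrite nuP; exact: pP.
Unshelve. all: by end_near. Qed.

(** * Upper bounds *)

(** Continuity into an arbitrary discrete target. For values in [Prop] it says that the condition is
    clopen. *)
Definition locconst (Y : Type) (g : baire -> Y) :=
  forall z, exists k, forall z', agree k z z' -> g z' = g z.

Lemma locconst_coord i : locconst (fun z : baire => z i).
Proof. by move=> z; exists i.+1 => z' zz'; rewrite -zz'. Qed.

Lemma locconst_cst (Y : Type) (y : Y) : locconst (fun=> y).
Proof. by move=> z; exists 0%N. Qed.

Lemma locconst_comp (Y W : Type) (f : Y -> W) g :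
  locconst g -> locconst (fun z => f (g z)).
Proof. by move=> lg z; have [k kP] := lg z; exists k => z' /kP ->. Qed.

Lemma locconst_bind (Y W : Type) (f : Y -> baire -> W) g :
  locconst g -> (forall y, locconst (f y)) -> locconst (fun z => f (g z) z).
Proof.
move=> lg lf z; have [j jP] := lg z; have [k kP] := lf (g z) z.
exists (maxn j k) => z' zz'.
rewrite jP; last by apply: agreeW zz'; exact: leq_maxl.
by rewrite kP//; apply: agreeW zz'; exact: leq_maxr.
Qed.

Lemma locconst_comp2 (Y Y' W : Type) (f : Y -> Y' -> W) g h :
  locconst g -> locconst h -> locconst (fun z => f (g z) (h z)).
Proof.
move=> lg lh; apply: (@locconst_bind _ _ (fun y z => f y (h z))) => // y.
exact: locconst_comp.
Qed.

Lemma locconst_sum (R : realType) n (f : nat -> baire -> R) :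
  (forall i, locconst (f i)) -> locconst (fun z => \sum_(i < n) f i z).
Proof.
move=> lf; elim: n => [|n ih].
  by under eq_fun do rewrite big_ord0; exact: locconst_cst.
under eq_fun do rewrite big_ord_recr /=.
exact: (locconst_comp2 (fun a b => a + b)).
Qed.

Lemma locconst_indic (R : realType) (h : baire -> baire) (A : set baire) :
  continuous h -> clopen A -> locconst (fun z => \1_A (h z) : R).
Proof.
move=> ch clA z; have [k kP] := ch z _ (clopen_near (h z) clA).
by exists k => z' /kP Az'; rewrite !indicE /in_mem /= /in_set Az'.
Qed.

(** Borel sets viewed as conditions, so that closure under connectives and countable quantifiers can
    be read off a formula. *)
Definition borelP (P : baire -> Prop) := <<s @open baire >> [set z | P z].

Lemma borelP_locconst (P : baire -> Prop) : locconst P -> borelP P.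
Proof.
move=> lP; apply: sub_sigma_algebra; rewrite openE => z Pz.
by have [k kP] := lP z; exists k => z' /kP; rewrite /= => ->.
Qed.

Lemma borelP_not P : borelP P -> borelP (fun z => ~ P z).
Proof. exact: (@measurableC _ (borel baire)). Qed.

Lemma borelP_and P Q : borelP P -> borelP Q -> borelP (fun z => P z /\ Q z).
Proof. exact: (@measurableI _ (borel baire)). Qed.

Lemma borelP_or P Q : borelP P -> borelP Q -> borelP (fun z => P z \/ Q z).
Proof. exact: (@measurableU _ (borel baire)). Qed.

Lemma borelP_exists (I : countType) (P : I -> baire -> Prop) :
  (forall i, borelP (P i)) -> borelP (fun z => exists i, P i z).
Proof.
move=> h; rewrite /borelP.
have -> : [set z | exists i, P i z] = \bigcup_i [set z | P i z].
  by apply/seteqP; split=> [z [i Pi]|z [i _ Pi]]; exists i.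
apply: (@countable_bigcupT_measurable _ (borel baire)) => //.
Qed.

Lemma borelP_forall (I : countType) (P : I -> baire -> Prop) :
  (forall i, borelP (P i)) -> borelP (fun z => forall i, P i z).
Proof.
move=> h; have -> : (fun z => forall i, P i z) = (fun z => ~ exists i, ~ P i z).
  apply/funext => z; apply/propext; split=> [Pz [i]//|Pz i].
  by apply: contrapT => nP; apply: Pz; exists i.
by apply: borelP_not; apply: borelP_exists => i; exact: borelP_not.
Qed.

Lemma borelP_imp (Q : Prop) P : (Q -> borelP P) -> borelP (fun z => Q -> P z).
Proof.
move=> h; have [q|nq] := pselect Q.
  have -> : (fun z => Q -> P z) = P; last exact: h.
  by apply/funext => z; apply/propext; split=> [/(_ q)|].
have -> : (fun z => Q -> P z) = (fun=> True); last first.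
  by apply: borelP_locconst; exact: locconst_cst.
by apply/funext => z; apply/propext; split.
Qed.

Definition evens (z : baire) : baire := fun m => z m.*2.
Definition odds (z : baire) : baire := fun m => z m.*2.+1.
Definition interleave (x y : baire) : baire :=
  fun m => if odd m then y m./2 else x m./2.

Lemma evens_interleave x y : evens (interleave x y) = x.
Proof. by apply/funext => m; rewrite /evens /interleave odd_double doubleK. Qed.

Lemma odds_interleave x y : odds (interleave x y) = y.
Proof.
by apply/funext => m; rewrite /odds /interleave /= odd_double /= uphalf_double.
Qed.

Lemma continuous_evens : continuous evens.
Proof.
move=> x A [k kA]; exists k.*2 => y xy; apply: kA => i ik.
by apply: xy; rewrite ltn_double.
Qed.

Lemma cvg_sum_pr_cyl (R : realType) (nu : prob_measure R baire) (s : seq nat) :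
  \sum_(i < K) pr nu (cyl (rcons s i)) @[K --> \oo] --> pr nu (cyl s).
Proof.
have mC (i : nat) := measurable_cyl (rcons s i).
have e : cyl s = \bigcup_i cyl (rcons s i).
  apply/seteqP; split=> [x xs|x [i _ /cyl_rcons[]//]].
  by exists (x (size s)) => //; exact/cyl_rcons.
have tC : trivIset setT (fun i : nat => cyl (rcons s i)).
  apply/trivIsetP => i j _ _ ij; rewrite -subset0 => x [].
  move=> /cyl_rcons[_ xi] /cyl_rcons[_ xj]; move/eqP : ij; apply.
  by rewrite -xi -xj.
have mU : measurable (\bigcup_i cyl (rcons s i) : set (borel baire)).
  by rewrite -e; exact: measurable_cyl.
have : (\sum_(0 <= i < n) nu (cyl (rcons s i)))%E @[n --> \oo] -->
    (pr nu (cyl s))%:E.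
  by rewrite -(prE nu (measurable_cyl s)) e; exact: measure_semi_sigma_additive.
move=> /fine_cvg; apply: cvg_trans.
apply: near_eq_cvg; apply: nearW => n /=; apply: EFin_inj.
rewrite -sumEFin big_mkord fineK.
  by apply: eq_bigr => i _; rewrite prE.
by apply/sum_fin_numP => i _ _; rewrite prE.
Qed.

(** * Having another limit measure as a projection of a Borel condition *)

Section upper_bounds.
Variable R : realType.
Local Notation emp := (empirical R shift).
Local Notation mu0 := (dirac_prob R zero).

(** A point z codes a pair: [evens z] is the point whose orbit is followed, [odds z] the subsequence
    of times. *)
Let freq (z : baire) (n : nat) (s : seq nat) : R :=
  pr (emp (evens z) (odds z n)) (cyl s).

Lemma continuous_iter_shift n : continuous (iter n shift).
Proof.
elim: n => [|n ih] x; first exact: cvg_id.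
exact: (continuous_comp (@ih x) (@continuous_shift _)).
Qed.

Let locconst_emp (h : baire -> baire) n s : continuous h ->
  locconst (fun z => pr (emp (h z) n) (cyl s)).
Proof.
move=> ch.
have -> : (fun z => pr (emp (h z) n) (cyl s)) =
    (fun z => n.+1%:R^-1 * \sum_(j < n.+1) \1_(cyl s) (iter j shift (h z))).
  by apply/funext => z; exact: (pr_empirical _ _ _ _ (measurable_cyl s)).
apply: (locconst_comp (fun a => n.+1%:R^-1 * a)).
apply: (@locconst_sum _ n.+1 (fun j z => \1_(cyl s) (iter j shift (h z)))) => j.
apply: (@locconst_indic R (iter j shift \o h)); last exact: clopen_cyl.
by move=> z; exact: (continuous_comp (@ch z) (@continuous_iter_shift j _)).
Qed.

Let locconst_freq n s : locconst (fun z => freq z n s).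
Proof.
apply: (@locconst_bind _ _ (fun m z => pr (emp (evens z) m) (cyl s))).
  exact: locconst_coord.
by move=> m; apply: locconst_emp; exact: continuous_evens.
Qed.

(** In order: the times increase; the frequency of each cylinder is Cauchy; no mass escapes through
    the children of a cylinder; some cylinder has frequencies that stay away from its mass under
    [mu0]. *)
Let witness (z : baire) : Prop :=
  [/\ forall n, (odds z n < odds z n.+1)%N,
      forall s k, exists N, forall m n, (N <= m)%N -> (N <= n)%N ->
        `|freq z m s - freq z n s| < k.+1%:R^-1,
      forall s k, exists K N, forall n, (N <= n)%N ->
        freq z n s - \sum_(i < K) freq z n (rcons s i) < k.+1%:R^-1
    & exists s k N, forall n, (N <= n)%N ->
        k.+1%:R^-1 < `|freq z n s - \1_(cyl s) zero| ].

Let borelP_witness : borelP witness.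
Proof.
have -> : witness = (fun z => ((((forall n, (odds z n < odds z n.+1)%N)) /\
   (forall s k, exists N, forall m n, (N <= m)%N -> (N <= n)%N ->
        `|freq z m s - freq z n s| < k.+1%:R^-1)) /\
   (forall s k, exists K N, forall n, (N <= n)%N ->
        freq z n s - \sum_(i < K) freq z n (rcons s i) < k.+1%:R^-1)) /\
   (exists s k N, forall n, (N <= n)%N ->
        k.+1%:R^-1 < `|freq z n s - \1_(cyl s) zero|)).
  by apply/funext => z; apply/propext; split=> [[]//|[[[]]]].
apply: borelP_and; [apply: borelP_and; [apply: borelP_and|]|].
- apply: borelP_forall => n; apply: borelP_locconst.
  apply: (locconst_comp2 (fun a b : nat => is_true (a < b)%N));
    exact: locconst_coord.
- apply: borelP_forall => s; apply: borelP_forall => k.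
  apply: borelP_exists => N; apply: borelP_forall => m; apply: borelP_forall => n.
  apply: borelP_imp => _; apply: borelP_imp => _; apply: borelP_locconst.
  exact: (locconst_comp2 (fun a b => is_true (`|a - b| < k.+1%:R^-1))).
- apply: borelP_forall => s; apply: borelP_forall => k.
  apply: borelP_exists => K; apply: borelP_exists => N; apply: borelP_forall => n.
  apply: borelP_imp => _; apply: borelP_locconst.
  apply: (locconst_comp2 (fun a b => is_true (a - b < k.+1%:R^-1))) => //.
  exact: (@locconst_sum R K (fun i z => freq z n (rcons s i))).
- apply: borelP_exists => s; apply: borelP_exists => k.
  apply: borelP_exists => N; apply: borelP_forall => n.
  apply: borelP_imp => _; apply: borelP_locconst.
  exact: (locconst_comp (fun a => is_true (k.+1%:R^-1 < `|a - _|))).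
Qed.

Let other_measures : set (prob_measure R baire) :=
  [set nu | invariant_measures shift nu /\ nu <> mu0].

(** A subsequence with limit other than [mu0] is stored in the odd coordinates. Conversely, the
    Cauchy and tightness clauses produce a limit, which is automatically invariant, and the last
    clause separates it from [mu0]. *)
Let G_meet_witness : G_meet shift other_measures = evens @` [set z | witness z].
Proof.
apply/seteqP; split=> [x [nu [[phi phi_inc xnu] [_ nuN]]]|_ [z [w1 w2 w3 w4] <-]].
  exists (interleave x phi); last exact: evens_interleave.
  have cv s : freq (interleave x phi) n s @[n --> \oo] --> pr nu (cyl s).
    have := weak_cvg_clopen (clopen_cyl s) xnu.
    by rewrite /freq evens_interleave odds_interleave.
  split.
  - by move=> n; rewrite odds_interleave phi_inc.
  - move=> s k; have k0 : 0 < k.+1%:R^-1 / 2 :> R by rewrite divr_gt0// invr_gt0.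
    have /cvgrPdist_lt/(_ _ k0) [N _ NP] := @cv s.
    exists N => m n Nm Nn; apply: (distm_lt_split (z := pr nu (cyl s))).
      by rewrite distrC; exact: NP.
    exact: NP.
  - move=> s k; have k0 : 0 < k.+1%:R^-1 / 2 :> R by rewrite divr_gt0// invr_gt0.
    (* The number K of children is chosen for the limit [nu]; being a finite sum, the bound then
       carries over to late frequencies. *)
    have /cvgrPdist_lt/(_ _ k0) [K _ /(_ K (leqnn K)) /= KP] :=
      @cvg_sum_pr_cyl R nu s.
    have hs : \sum_(i < K) freq (interleave x phi) n (rcons s i) @[n --> \oo] -->
        \sum_(i < K) pr nu (cyl (rcons s i)).
      by apply: (cvg_big (op := +%R)) => [|i _]; [exact: add_continuous|exact: cv].
    have : freq (interleave x phi) n s -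
        \sum_(i < K) freq (interleave x phi) n (rcons s i) @[n --> \oo] -->
        pr nu (cyl s) - \sum_(i < K) pr nu (cyl (rcons s i)) by exact: cvgB.
    move=> /cvgrPdist_lt/(_ _ k0) [N _ NP]; exists K, N => n /NP /=.
    move: KP; rewrite !ltr_norml => /andP[_ h1] /andP[h2 _].
    by move: h1 h2; set e := k.+1%:R^-1; lra.
  - have [s sN] : exists s, pr nu (cyl s) <> \1_(cyl s) zero.
      apply: contrapT => h; apply: nuN; apply: prob_cyl_ext => s.
      rewrite pr_dirac; last exact: measurable_cyl.
      by apply: contrapT => sN; apply: h; exists s.
    set c : R := \1_(cyl s) zero in sN *.
    have d0 : 0 < `|pr nu (cyl s) - c| / 2.
      by rewrite divr_gt0// normr_gt0 subr_eq0; apply/eqP.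
    have [k kP] := invS_lt d0.
    have /cvgrPdist_lt/(_ _ d0) [N _ NP] := @cv s.
    exists s, k, N => n /NP /= h; apply: lt_trans kP _.
    have := ler_distD (freq (interleave x phi) n s) (pr nu (cyl s)) c.
    by rewrite -/c; lra.
have [nu nuP] : exists nu : prob_measure R baire,
    (fun n => emp (evens z) (odds z n)) @ \oo --> nu.
  apply: limit_measure_exists => [s|s e e0].
    apply/cauchy_cvgP; apply: cauchy_exP => e e0; have [k ke] := invS_lt e0.
    have [N NP] := w2 s k; exists (freq z N s).
    by exists N => // n Nn; apply: lt_trans ke; exact: NP.
  have [k ke] := invS_lt e0; have [K [N NP]] := w3 s k; exists K.
  by exists N => // n /NP h; exact: lt_trans ke.
have lim : limit_measures shift (evens z) nu.
  by exists (odds z) => //; apply: homo_ltn w1; exact: ltn_trans.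
exists nu; split=> //; split; first exact: limit_measures_invariant lim.
move=> nuE; have [s [k [N NP]]] := w4.
have k0 : 0 < k.+1%:R^-1 :> R by rewrite invr_gt0.
have := weak_cvg_clopen (clopen_cyl s) nuP.
rewrite nuE pr_dirac; last exact: measurable_cyl.
move=> /cvgrPdist_lt /(_ _ k0) [M _ MP].
have := MP (maxn M N) (leq_maxl _ _); have := NP (maxn M N) (leq_maxr _ _).
by rewrite /= distrC => h1 /(lt_trans h1); rewrite ltxx.
Qed.

Lemma G_meetE : G_meet shift other_measures = ~` G_sub shift [set mu0].
Proof.
apply/seteqP; split=> x.
  by move=> [nu [xnu [_ nuN]]] h; apply: nuN; exact: h.
move=> h; apply: contrapT => h'; apply: h => nu xnu; apply: contrapT => nuN.
by apply: h'; exists nu; split=> //; split=> //; exact: limit_measures_invariant xnu.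
Qed.

Lemma analytic_G_meet : analytic R (G_meet shift other_measures).
Proof.
exists baire, [set z | witness z], evens; split.
- exact: polish_baire.
- exact: borelP_witness.
- exact: continuous_evens.
- exact: G_meet_witness.
Qed.

Lemma G_eqE : G_eq shift [set mu0] =
  G_sub shift [set mu0] `&` [set x | limit_measures shift x mu0].
Proof.
apply/seteqP; split=> x; rewrite /G_eq /G_sub /=; first by move=> e; split; rewrite /= e.
by move=> [h1 h2]; apply/seteqP; split=> // _ ->.
Qed.

Lemma borelP_limit_mu0 : borelP (fun z => limit_measures shift (evens z) mu0).
Proof.
have -> : (fun z => limit_measures shift (evens z) mu0) =
    (fun z => forall k N, exists n, (N <= n)%N /\
      1 - k.+1%:R^-1 <= pr (emp (evens z) n) (cyl (mkseq zero k))).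
  apply/funext => z; apply/propext; rewrite limit_dirac.
  by split=> h k N; have := h k N => -[n]; [exists n|case; exists n].
apply: borelP_forall => k; apply: borelP_forall => N; apply: borelP_exists => n.
apply: borelP_and; apply: borelP_locconst; first exact: locconst_cst.
apply: (locconst_comp (fun a => is_true (1 - k.+1%:R^-1 <= a))).
by apply: locconst_emp; exact: continuous_evens.
Qed.

(** A point lies outside exactly when some other measure is a limit or [mu0] is not; the second
    condition is Borel by [limit_dirac]. *)
Lemma coanalytic_G_eq : coanalytic R (G_eq shift [set mu0]).
Proof.
exists baire, [set z | witness z \/ ~ limit_measures shift (evens z) mu0], evens.
split.
- exact: polish_baire.
- by apply: borelP_or borelP_witness _; apply: borelP_not; exact: borelP_limit_mu0.
- exact: continuous_evens.
- rewrite G_eqE setCI -G_meetE G_meet_witness.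
  apply/seteqP; split=> [x [[z wz <-]|xN]|_ [z [wz|zN] <-]].
  + by exists z => //; left.
  (* The second x is an arbitrary filler for the odd coordinates. *)
  + by exists (interleave x x); rewrite ?evens_interleave//=; right;
      rewrite evens_interleave.
  + by left; exists z.
  + by right.
Qed.

End upper_bounds.

(** * Analytic sets as sections of clopen trees *)

Lemma baire_cvg_reindex (u : nat -> baire) (l : baire) (r : nat -> nat) :
  u @ \oo --> l -> (fun k => u k \o r : baire) @ \oo --> (l \o r : baire).
Proof.
move=> /baire_cvgP ul; apply/baire_cvgP => k.
apply: filterS (ul (\max_(i < k) r i).+1) => n h i ik /=; apply: h.
by rewrite ltnS; exact: (leq_bigmax (Ordinal ik)).
Qed.

Section suslin_sets.
Variable Z : topologicalType.
Implicit Types (F : baire -> Z -> Prop) (A : set Z).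

Definition seq_closed F := forall (u : nat -> baire) (z : nat -> Z) ul zl,
  u @ \oo --> (ul : baire) -> z @ \oo --> zl ->
  (\forall k \near \oo, F (u k) (z k)) -> F ul zl.

(** The projection along Baire space of a relation that is closed under limits of sequences. *)
Definition suslin A :=
  exists2 F, seq_closed F & forall z, A z <-> exists u, F u z.

Lemma suslin_closed A : closed A -> suslin A.
Proof.
move=> cA; exists (fun=> A).
  by move=> u z ul zl _ zzl zA; exact: (@closed_cvg _ _ _ _ z A cA zA _ zzl).
by move=> z; split=> [Az|[]//]; exists (fun=> 0%N).
Qed.

Lemma suslin_bigcup (A : nat -> set Z) :
  (forall i, suslin (A i)) -> suslin (\bigcup_i A i).
Proof.
move=> sA.
have /choice [F FP] i :
    exists F, seq_closed F /\ forall z, A i z <-> exists u, F u z.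
  by have [F] := sA i; exists F.
(* The entry 0 names the index of the union, the remaining entries are the witness. Along a
   convergent sequence that index is eventually constant. *)
exists (fun u => F (u 0%N) (fun n => u n.+1)).
  move=> u z ul zl uul zzl Fuz; have [Fc _] := FP (ul 0%N).
  have := Fc (fun k => u k \o succn) z (ul \o succn) zl.
  move=> /(_ (@baire_cvg_reindex u ul succn uul) zzl); apply.
  move/baire_cvgP : uul => /(_ 1%N) h.
  by move: h Fuz; apply: filterS2 => k /(_ 0%N isT) <-.
move=> z; split=> [[i _]|[u Fuz]].
  have [_ +] := FP i; move=> /(_ z) h /h[u Fuz].
  by exists (fun n => if n is m.+1 then u m else i).
by exists (u 0%N) => //; have [_ h] := FP (u 0%N); apply/h; eexists; exact: Fuz.
Qed.

Lemma suslin_bigcap (A : nat -> set Z) :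
  (forall i, suslin (A i)) -> suslin (\bigcap_i A i).
Proof.
move=> sA.
have /choice [F FP] i :
    exists F, seq_closed F /\ forall z, A i z <-> exists u, F u z.
  by have [F] := sA i; exists F.
pose row (i : nat) (u : baire) : baire := u \o (fun n : nat => pickle (i, n)).
(* A single u codes one witness for each i, read along the pairing [pickle (i, n)]. *)
exists (fun u z => forall i, F i (row i u) z).
  move=> u z ul zl uul zzl Fuz i; have [Fc _] := FP i.
  have := Fc (fun k => row i (u k)) z (row i ul) zl.
  move=> /(_ (@baire_cvg_reindex u ul _ uul) zzl); apply.
  by apply: filterS Fuz => k; exact.
move=> z; split=> [h|[u Fuz] i _]; last first.
  by have [_ h] := FP i; apply/h; eexists; exact: Fuz.
have /choice [u uP] i : exists u, F i u z.
  by have [_ +] := FP i; move=> /(_ z) <-; exact: h.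
exists (fun m => if unpickle m is Some (i, n) then u i n else 0%N) => i.
have -> : row i (fun m => if unpickle m is Some (i, n) then u i n else 0%N) = u i.
  by apply/funext => n; rewrite /row /= pickleK.
exact: uP.
Qed.

Variables (R : realType) (d : Z -> Z -> R).
Hypotheses (dm : is_metric d) (dc : compatible_metric d).

(** In a metric space an open set is the countable union of the closed sets of points whose ball of
    radius 1/(n + 1) stays inside it. *)
Lemma suslin_open A : open A -> suslin A.
Proof.
move=> oA; have [d0 dE dC dT] := dm.
have -> : A = \bigcup_n [set z | forall y, d z y < n.+1%:R^-1 -> A y].
  apply/seteqP; split=> [z Az|z [n _ h]]; last first.
    by apply: h; rewrite ((dE z z).2 erefl) invr_gt0.
  have /dc [e e0 eA] : nbhs z A by exact: open_nbhs_nbhs.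
  have [n ne] := invS_lt e0; exists n => // y /= zy.
  by apply: eA => /=; exact: lt_trans ne.
apply: suslin_bigcup => n; apply: suslin_closed; rewrite -openC openE => z /= zN.
have [y zy nAy] : exists2 y, d z y < n.+1%:R^-1 & ~ A y.
  by apply: contrapT => h; apply: zN => y zy; apply: contrapT => nAy; apply: h; exists y.
apply/dc; exists (n.+1%:R^-1 - d z y); first by rewrite subr_gt0.
move=> w /= zw h; apply: nAy; apply: h; apply: le_lt_trans (dT w z y) _.
by rewrite dC -ltrBrDr.
Qed.

Lemma suslin_borel A : <<s @open Z >> A -> suslin A.
Proof.
(* The sets that are Suslin together with their complements form a sigma-algebra. *)
suff : <<s @open Z >> `<=` [set A | suslin A /\ suslin (~` A)] by move=> h /h[].
apply: smallest_sub; last first.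
  by move=> U oU; split; [exact: suslin_open|apply: suslin_closed; rewrite closedC].
split.
- split; apply: suslin_closed; first exact: closed0.
  by rewrite setC0; exact: closedT.
- by move=> U [sU sUC]; rewrite setTD /= setCK.
- move=> U sU; split; first by apply: suslin_bigcup => i; have [] := sU i.
  by rewrite setC_bigcup; apply: suslin_bigcap => i; have [] := sU i.
Qed.

End suslin_sets.

(** * Countable covers and separating clopen sets *)

Lemma separable_cover (R : realType) (Z : topologicalType) (d : Z -> Z -> R) :
  separable_space Z -> polish_metric d ->
  exists Q : nat -> nat -> set Z, (forall n z, exists i, Q i n z) /\
    forall i n z z', Q i n z -> Q i n z' -> d z z' < n.+1%:R^-1 * 2.
Proof.
move=> [D /countable_injP [c c_inj] dD] [[d0 dE dC dT] dc _].
(* The map [c] numbers D, so this is the ball of radius 1/(n + 1) about the point numbered i, and is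
   empty if there is none. *)
exists (fun i n => [set z | exists2 a, D a & c a = i /\ d a z < n.+1%:R^-1]).
split=> [n z|i n z z' [a Da [ai az]] [b Db [bi bz']]].
  have n0 : 0 < n.+1%:R^-1 :> R by rewrite invr_gt0.
  have : nbhs z [set y | d z y < n.+1%:R^-1] by apply/dc; exists n.+1%:R^-1.
  rewrite nbhsE => -[B [oB Bz] BS].
  have [a [Ba Da]] := dD B (ex_intro _ z Bz) oB.
  by exists (c a), a => //; split=> //; rewrite dC; exact: BS.
have ab : a = b by apply: c_inj; rewrite ?inE// ai bi.
subst b; apply: le_lt_trans (dT z a z') _; rewrite dC mulr2n mulrDr mulr1.
exact: ltrD.
Qed.

(** One clopen set is chosen for each pair of basic balls that some clopen set separates. Any two
    distinct points lie in such a pair, by the clopen base and small enough balls. *)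
Lemma separating_clopens (R : realType) (Y : topologicalType) :
  polish R Y -> clopen_base Y ->
  exists W : nat -> set Y, (forall i, clopen (W i)) /\
    forall x y, (forall i, W i x <-> W i y) -> x = y.
Proof.
move=> [sY [d pd]] cb; have [Q [Ocov Odiam]] := separable_cover sY pd.
have [[d0 dE dC dT] dc _] := pd.
have Obase (x : Y) (A : set Y) : nbhs x A -> exists i n, Q i n x /\ Q i n `<=` A.
  move=> /dc[e e0 eA]; have [n ne] : exists n : nat, n.+1%:R^-1 < e / 2.
    by apply: invS_lt; rewrite divr_gt0.
  have [i xi] := Ocov n x; exists i, n; split=> // y yi; apply: eA => /=.
  apply: lt_trans (Odiam _ _ _ _ xi yi) _; by rewrite -ltr_pdivlMr.
pose P (q : nat * nat * (nat * nat)) : set (set Y) :=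
  [set W | [/\ clopen W, Q q.1.1 q.1.2 `<=` W & Q q.2.1 q.2.2 `<=` ~` W]].
exists (fun k => if unpickle k is Some q then xget set0 (P q) else set0); split.
  move=> k; case: unpickle => [q|]; last by split; [exact: open0|exact: closed0].
  by case: xgetP => [W _ []//|_]; split; [exact: open0|exact: closed0].
move=> x y h; apply: contrapT => xy.
have dxy0 : 0 < d x y.
  by rewrite lt_neqAle d0 andbT eq_sym; apply/eqP => /dE.
have nx : nbhs x [set z | d x z < d x y] by apply/dc; exists (d x y).
have [V [[oV cV] Vx VS]] := cb x _ nx.
have Vy : (~` V) y by move=> /VS /=; rewrite ltxx.
have [i [n [xi iV]]] : exists i n, Q i n x /\ Q i n `<=` V.
  by apply: Obase; exact: open_nbhs_nbhs.
have [j [m [yj jV]]] : exists i n, Q i n y /\ Q i n `<=` ~` V.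
  by apply: Obase; apply: open_nbhs_nbhs; split=> //; rewrite openC.
have := h (pickle ((i, n), (j, m))); rewrite pickleK.
case: xgetP => [W _ [_ /= iW jW] [/(_ (iW _ xi)) + _]|]; first exact: jW.
by move=> /(_ V); case.
Qed.

Lemma analytic_tree (R : realType) (Y : topologicalType) (B : set Y) :
  polish R Y -> clopen_base Y -> analytic R B ->
  exists S : Y -> seq nat -> Prop,
    [/\ forall s, clopen [set y | S y s],
        forall y s t, S y (s ++ t) -> S y s
      & forall y, B y <-> exists b : nat -> nat, forall n, S y (mkseq b n)].
Proof.
move=> pY cb [Z [C [f [[sZ [d pd]] bC cf ->]]]].
have [W [Wcl Wsep]] := separating_clopens pY cb.
have [Q [Ocov Odiam]] := separable_cover sZ pd.
have [dm dc dcomp] := pd.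
have [F Fcl FP] := suslin_borel dm dc bC.
(* The entries of s code pairs: values of a witness u for z, and indices v of shrinking balls around
   z. The equation [f z = y] is tested only on the first [size s] sets [W i], which makes the
   condition clopen in y. *)
pose S y s := exists u v z, [/\ F u z, s = mkseq (fun i => pickle (u i, v i)) (size s),
  forall i, (i < size s)%N -> Q (v i) i z &
  forall i, (i < size s)%N -> W i (f z) <-> W i y].
exists S; split.
- move=> s.
  have near_eq k y : \forall y' \near y, forall i, (i < k)%N -> W i y' <-> W i y.
    elim: k => [|k ih]; first by apply: nearW.
    have : \forall y' \near y, W k y' <-> W k y.
      by apply: filterS (clopen_near y (Wcl k)) => y' ->.
    move: ih; apply: filterS2 => y' h1 h2 i; rewrite ltnS leq_eqVlt.
    by move=> /predU1P[->//|]; exact: h1.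
  have trans y y' : (forall i, (i < size s)%N -> W i y' <-> W i y) ->
      S y s -> S y' s.
    move=> h [u [v [z [Fuz es Oz Wz]]]]; exists u, v, z; split=> // i ils.
    by rewrite Wz// h.
  split; first rewrite openE => y /= Sy.
    by apply: filterS (near_eq (size s) y) => y' h; exact: trans Sy.
  rewrite -openC openE => y /= Sy.
  apply: filterS (near_eq (size s) y) => y' h Sy'; apply: Sy.
  by apply: trans Sy' => i /h[].
- move=> y s t [u [v [z [Fuz es Oz Wz]]]]; exists u, v, z; split=> //.
  + have := congr1 (take (size s)) es; rewrite take_size_cat// => {1}->.
    by rewrite /mkseq -map_take take_iota size_cat (minn_idPl (leq_addr _ _)).
  + by move=> i ils; apply: Oz; rewrite size_cat ltn_addr.
  + by move=> i ils; apply: Wz; rewrite size_cat ltn_addr.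
move=> y; split=> [[z Cz <-]|[b bP]].
  have [u Fuz] := (FP z).1 Cz.
  have /choice [v vP] n : exists i, Q i n z by exact: Ocov.
  exists (fun i => pickle (u i, v i)) => n; exists u, v, z.
  by rewrite size_mkseq; split.
have /choice [w wP] n : exists w : baire * baire * Z, [/\ F w.1.1 w.2,
    forall i, (i < n)%N -> b i = pickle (w.1.1 i, w.1.2 i),
    forall i, (i < n)%N -> Q (w.1.2 i) i w.2 &
    forall i, (i < n)%N -> W i (f w.2) <-> W i y].
  have [u [v [z]]] := bP n; rewrite size_mkseq => -[Fuz es Oz Wz].
  exists (u, v, z); split=> //= i ilt.
  by have := congr1 (nth 0%N ^~ i) es; rewrite !nth_mkseq.
(* Both witnesses are decoded from the same entry [b i], so they agree there although each length n
   has its own witness. *)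
have wE n i : (i < n)%N ->
    (w n).1.1 i = (w i.+1).1.1 i /\ (w n).1.2 i = (w i.+1).1.2 i.
  move=> ilt; have [_ /(_ i ilt) e1 _ _] := wP n.
  have [_ /(_ i (ltnSn i)) e2 _ _] := wP i.+1.
  by move: e1; rewrite e2 => /(pcan_inj pickleK) [-> ->].
have [z zP] : exists z : Z, (fun n => (w n).2) @ \oo --> z.
  apply: dcomp => e e0; have [N Ne] : exists n : nat, n.+1%:R^-1 < e / 2.
    by apply: invS_lt; rewrite divr_gt0.
  (* Beyond N all the points lie in the same ball of level N, hence within 2/(N + 1) of each
     other. *)
  exists N.+1 => m n Nm Nn.
  have [_ _ /(_ N Nm) h1 _] := wP m; have [_ _ /(_ N Nn) h2 _] := wP n.
  move: h1 h2; rewrite (wE m N Nm).2 (wE n N Nn).2 => h1 h2.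
  apply: lt_trans (Odiam _ _ _ _ h1 h2) _; by rewrite -ltr_pdivlMr.
exists z.
  apply/FP; exists (fun i => (w i.+1).1.1 i).
  apply: (Fcl (fun n => (w n).1.1) _ _ _ _ zP).
    apply/baire_cvgP => k; exists k => // n /= kn i ik.
    by rewrite (wE n i (leq_trans ik kn)).1.
  by apply: nearW => n; have [] := wP n.
apply: Wsep => i.
have fz : (fun n => f (w n).2) @ \oo --> f z.
  exact: (continuous_cvg _ (@cf z) zP).
have [oW cW] := Wcl i.
have ev : \forall n \near \oo, W i (f (w n).2) <-> W i y.
  by exists i.+1 => // n /= ni; have [_ _ _ ->] := wP n.
split=> [Wz|Wy].
  have : \forall n \near \oo, W i (f (w n).2) by apply: fz; exact: open_nbhs_nbhs.
  move=> h; near \oo => n; have [+ _] : W i (f (w n).2) <-> W i y by near: n.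
  by apply; near: n.
apply: (@closed_cvg _ _ _ eventually_filter (fun n => f (w n).2) (W i) cW _ _ fz).
by apply: filterS ev => n [_]; exact.
Unshelve. all: by end_near. Qed.

(** * The reduction *)

(* The times i with (k + 1)! <= i + 1 < (k + 2)! form the block k. *)
Fixpoint block (i : nat) : nat :=
  if i is j.+1 then
    if i.+1 == (block j).+2`! then (block j).+1 else block j
  else 0%N.

Lemma blockP i : ((block i).+1`! <= i.+1 < (block i).+2`!)%N.
Proof.
elim: i => // i /andP[h1 h2] /=; case: eqVneq => [e|ne].
  rewrite -e leqnn /= [X in (_ < X)%N]factS -e.
  by rewrite -{1}[i.+2]mul1n ltn_mul2r.
rewrite ltn_neqAle ne h2 /= andbT; exact: leqW.
Qed.

Lemma block_ge k i : (k.+1`! <= i.+1)%N -> (k <= block i)%N.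
Proof.
move=> ki; rewrite leqNgt; apply/negP => lt.
have /andP[_] := blockP i; rewrite ltnNge => /negP; apply.
by apply: leq_trans ki; apply: leq_fact.
Qed.

Lemma blockE k i : (k.+1`! <= i.+1 < k.+2`!)%N -> block i = k.
Proof.
move=> /andP[h1 h2]; apply/eqP; rewrite eqn_leq (block_ge h1) andbT leqNgt.
apply/negP => lt; have /andP[h3 _] := blockP i.
move: h2; rewrite ltnNge => /negP; apply; apply: leq_trans h3.
exact: leq_fact.
Qed.

Lemma code_ge_size s : (size s <= CodeSeq.code s)%N.
Proof.
elim: s => // n s ih; rewrite /= -/(CodeSeq.code s).
have : (1 <= 2 ^ n)%N by rewrite expn_gt0.
by move: ih; rewrite /CodeSeq.code /=; nia.
Qed.

(** * Frequencies along blocks *)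

Section block_frequency.
Variable R : realType.
Local Notation emp := (empirical R shift).

Lemma pr_empirical_ge x n (A : set baire) a c :
  measurable (A : set (borel baire)) -> (c <= n.+1)%N ->
  (forall j, (a <= j < c)%N -> A (iter j shift x)) ->
  (c - a)%:R / n.+1%:R <= pr (emp x n) A.
Proof.
move=> mA cn h; rewrite pr_empirical// mulrC ler_wpM2l ?invr_ge0//.
rewrite -(big_mkord xpredT (fun j => \1_A (iter j shift x))).
have [ac|ca] := leqP a c; last first.
  by rewrite (eqP (ltnW ca : _ - _ == 0)%N); apply: sumr_ge0 => j _; rewrite indicE.
rewrite (big_cat_nat (leq0n a) (leq_trans ac cn)) /= (big_cat_nat ac cn) /=.
have -> : \sum_(a <= j < c) \1_A (iter j shift x) = (c - a)%:R :> R.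
  rewrite big_nat (eq_bigr (fun=> 1)) => [|j /h Aj].
    by rewrite -big_nat sumr_const_nat.
  by rewrite indicE mem_set.
rewrite addrCA lerDl addr_ge0//; apply: sumr_ge0 => j _; by rewrite indicE.
Qed.

Lemma pr_empirical_le x n (A : set baire) N :
  measurable (A : set (borel baire)) ->
  (forall j, (N <= j)%N -> ~ A (iter j shift x)) ->
  pr (emp x n) A <= N%:R / n.+1%:R.
Proof.
move=> mA h; rewrite pr_empirical// mulrC ler_wpM2r ?invr_ge0//.
have -> : N%:R = \sum_(j < N) (1 : R) by rewrite sumr_const card_ord.
rewrite -(big_mkord xpredT (fun j => \1_A (iter j shift x))).
rewrite -(big_mkord xpredT (fun=> 1)).
have [nN|Nn] := leqP n.+1 N.
  rewrite (big_cat_nat (leq0n _) nN) /=; apply: ler_wpDr; first exact: sumr_ge0.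
  by apply: ler_sum => j _; rewrite indicE lern1 leq_b1.
rewrite (big_cat_nat (leq0n _) (ltnW Nn)) /= [X in _ + X]big_nat.
rewrite [X in _ + X]big1 ?addr0.
  by apply: ler_sum => j _; rewrite indicE lern1 leq_b1.
by move=> j /andP[Nj _]; rewrite indicE memNset//; exact: h.
Qed.

(* The times before block k are at most (k + 1)! out of about (k + 2)!. *)
Lemma block_frequency e (r : nat -> nat) k m :
  (forall i, block i = k -> forall l, (l < m)%N -> e i l = r l) ->
  1 - m.+1%:R / k.+1%:R <=
    pr (emp (of_rows e) (k.+2`! - 2)) (cyl (mkseq (of_rows (fun=> r)) m)).
Proof.
move=> er; have k2 : (2 <= k.+2`!)%N by rewrite (@leq_fact 2).
have n1 : (k.+2`! - 2).+1 = (k.+2`! - 1)%N by lia.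
(* The average stops at the last time of block k. The last m times are given up, since the first m
   coordinates at time j may read rows up to j + m - 1. *)
have := @pr_empirical_ge (of_rows e) (k.+2`! - 2) (cyl (mkseq (of_rows (fun=> r)) m))
  k.+1`! (k.+2`! - 1 - m) (measurable_cyl _).
rewrite n1 => /(_ (leq_subr _ _)) h; apply: le_trans (h _); last first.
  move=> j /andP[j1 j2]; apply/cyl_mkseq => i im.
  rewrite iter_shift_of_rows /of_rows er//.
    apply: blockE; have := row_index_le i; have := fact_gt0 k.+1.
    by move: j1 j2; lia.
  exact: leq_ltn_trans (col_index_le i) im.
have nz : 0 < (k.+2`! - 1)%:R :> R by rewrite ltr0n subn_gt0.
have nat_le : ((m + k.+1`!) * k.+1 <= m.+1 * (k.+2`! - 1))%N.
  rewrite (factS k.+1); move: (k.+1`!) (fact_gt0 k.+1) => F F0.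
  have h1 : (m + F <= m.+1 * F)%N by nia.
  have h2 : (F * k.+1 <= k.+2 * F - 1)%N by nia.
  apply: leq_trans (leq_mul h1 (leqnn k.+1)) _.
  by rewrite -mulnA leq_mul2l h2 orbT.
have sub_ge : (k.+2`! - 1)%:R - (m + k.+1`!)%:R <= (k.+2`! - 1 - m - k.+1`!)%:R :> R.
  by rewrite lerBlDr -natrD ler_nat; lia.
apply: (@le_trans _ _ (1 - (m + k.+1`!)%:R / (k.+2`! - 1)%:R)).
  by rewrite lerD2l lerN2 ler_pdivrMr// mulrAC ler_pdivlMr// -!natrM ler_nat.
by rewrite -[X in X - _](divff (lt0r_neq0 nz)) -mulrBl ler_wpM2r// invr_ge0 ltW.
Qed.

End block_frequency.

(** * Points in the support of a limit measure *)

Section support.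
Variables (R : realType) (nu : prob_measure R baire).

(** The union of all null cylinders is countable, hence null. If it contained every point other than
    x, [nu] would be the point mass at x. *)
Lemma support_point (x : baire) : nu <> dirac_prob R x ->
  exists2 z, z <> x & forall k, 0 < pr nu (cyl (mkseq z k)).
Proof.
move=> nuN; apply: contrapT => h; apply: nuN.
pose null n : set (borel baire) := let s := CodeSeq.decode n in
  if `[< pr nu (cyl s) = 0 >] then cyl s else set0.
have mnull n : measurable (null n).
  by rewrite /null; case: ifP => _ //; exact: measurable_cyl.
have mN : measurable (\bigcup_n null n) by exact: bigcupT_measurable.
have N0 : pr nu (\bigcup_n null n) = 0.
  have /measure_negligible -/(_ mN) : nu.-negligible (\bigcup_n null n).
    apply: negligible_bigcup => n; apply/negligibleP => //.
    rewrite /null; case: asboolP => [e|_]; last exact: measure0.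
    by apply: etrans (prE nu (measurable_cyl _)) _; rewrite e.
  by rewrite /pr => ->.
have sub z : z <> x -> (\bigcup_n null n) z.
  move=> zx; apply: contrapT => zN; apply: h; exists z => // k.
  rewrite lt_neqAle pr_ge0 andbT eq_sym; apply/eqP => e; apply: zN.
  exists (CodeSeq.code (mkseq z k)) => //; rewrite /null CodeSeq.codeK.
  by case: asboolP => // _; exact: mem_cyl_mkseq.
apply: prob_cyl_ext => s; have mC := measurable_cyl s.
rewrite pr_dirac// indicE; apply/eqP; have [sx|sx] := pselect (cyl s x).
  rewrite (mem_set sx) /= -subr_eq0 -oppr_eq0 opprB -prC// eq_le pr_ge0 andbT -N0.
  apply: pr_le => //; first exact: (@measurableC _ (borel baire)).
  by move=> y ys; apply: sub => yx; apply: ys; rewrite yx.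
rewrite (memNset sx) /= mulr0n eq_le pr_ge0 andbT -N0.
by apply: pr_le => // y ys; apply: sub => yx; apply: sx; rewrite -yx.
Qed.

(** If the visits stopped before time N, the frequency of the cylinder at time n would be at most
    N/(n + 1), which tends to 0. *)
Lemma support_recurrent x z J N : limit_measures shift x nu ->
  0 < pr nu (cyl (mkseq z J)) ->
  exists2 i, (N <= i)%N & agree J z (iter i shift x).
Proof.
move=> [phi phi_inc xnu] c0; apply: contrapT => h.
have mC := measurable_cyl (mkseq z J).
have le n := @pr_empirical_le R x (phi n) _ N mC.
have {}le n : pr (empirical R shift x (phi n)) (cyl (mkseq z J)) <=
    N%:R / (phi n).+1%:R.
  by apply: le => j Nj /cyl_mkseq zj; apply: h; exists j.
set c := pr nu _ in c0; have c20 : 0 < c / 2 by rewrite divr_gt0.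
have [k kP] : exists k : nat, k.+1%:R^-1 < c / 2 / N.+1%:R.
  by apply: invS_lt; rewrite divr_gt0.
have := weak_cvg_clopen (clopen_cyl (mkseq z J)) xnu.
move=> /cvgrPdist_lt /(_ _ c20) [M _ MP].
have /= := MP (maxn M k) (leq_maxl _ _).
rewrite ltr_norml -/c => /andP[_ h1].
suff : N%:R / (phi (maxn M k)).+1%:R < c / 2.
  by move=> /(le_lt_trans (le (maxn M k))); move: h1; lra.
apply: (@le_lt_trans _ _ (N.+1%:R / k.+1%:R)); last first.
  by rewrite mulrC -ltr_pdivlMr// ltr0n.
apply: ler_pM => //; first by rewrite ler_nat.
rewrite lef_pV2 ?posrE ?ltr0n// ler_nat ltnS.
by apply: leq_trans (increasing_ge_id phi_inc _); exact: leq_maxr.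
Qed.

End support.

(* Even blocks are filled with zero rows.  The block 2 n + 1 repeats a row that
   starts with the n-th finite sequence if it lies in [P], and that escapes to
   infinity with n everywhere else. *)
Definition tree_row (P : seq nat -> Prop) (n l : nat) : nat :=
  let s := CodeSeq.decode n in
  if `[< P s >] && (l < size s)%N then (nth 0%N s l).+1 else n.+1.

Definition tree_rows (P : seq nat -> Prop) (i l : nat) : nat :=
  if odd (block i) then tree_row P (block i)./2 l else 0%N.

Definition tree_point (P : seq nat -> Prop) : baire := of_rows (tree_rows P).

Section tree_point_limits.
Variables (R : realType) (P : seq nat -> Prop).
Local Notation mu0 := (dirac_prob R zero).

Lemma limit_block (r : nat -> nat) :
  (forall m N, exists2 k, (N <= k)%N &
    forall i, block i = k -> forall l, (l < m)%N -> tree_rows P i l = r l) ->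
  limit_measures shift (tree_point P) (dirac_prob R (of_rows (fun=> r))).
Proof.
move=> h; apply/limit_dirac => m N.
(* With k at least the square of m + 1, the error (m + 1)/(k + 1) of [block_frequency] is at most
   1/(m + 1). *)
have [k kN kP] := h m (m.+1 * m.+1 + N)%N.
exists (k.+2`! - 2)%N.
  have := fact_geq k.+2; have : (N <= k)%N by apply: leq_trans kN; exact: leq_addl.
  by move=> Nk kf; apply: leq_trans Nk _; rewrite leq_subRL ?(leq_trans _ kf)//; exact: kf.
apply: le_trans (block_frequency R kP).
rewrite lerD2l lerN2 ler_pdivrMr// mulrC ler_pdivlMr// -natrM ler_nat.
by apply: leqW; apply: leq_trans kN; exact: leq_addr.
Qed.

Lemma limit_tree_point_zero : limit_measures shift (tree_point P) mu0.
Proof.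
have -> : zero = of_rows (fun _ _ => 0%N) by [].
apply: limit_block => m N; exists N.*2; first by rewrite -addnn leq_addr.
by move=> i ik l _; rewrite /tree_rows ik odd_double.
Qed.

Lemma limit_tree_point_branch b : (forall n, P (mkseq b n)) ->
  exists nu : prob_measure R baire,
    limit_measures shift (tree_point P) nu /\ nu <> mu0.
Proof.
move=> bP; pose z := of_rows (fun _ l => (b l).+1).
exists (dirac_prob R z); split.
  (* Length at least m makes the row follow the branch on its first m entries; length at least N
     makes the code of s, hence the block, late enough. *)
  apply: limit_block => m N; pose s := mkseq b (maxn m N).
  exists (CodeSeq.code s).*2.+1.
    apply: leqW; rewrite -addnn; apply: leq_trans (leq_addr _ _).
    apply: leq_trans (code_ge_size s); rewrite size_mkseq; exact: leq_maxr.
  move=> i ik l lm; rewrite /tree_rows ik /= odd_double /= uphalf_double.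
  rewrite /tree_row CodeSeq.codeK; case: asboolP => [_|[]]; last exact: bP.
  have lm' : (l < maxn m N)%N by apply: leq_trans lm _; exact: leq_maxl.
  by rewrite size_mkseq lm' /= nth_mkseq.
(* All entries of [z] are successors, so the two measures give the cylinder of the sequence 0 the
   masses 0 and 1. *)
move=> e; have := congr1 (fun nu => pr nu (cyl [:: 0%N])) e.
rewrite !pr_dirac; try exact: measurable_cyl.
rewrite !indicE memNset; last by move=> /cylP /(_ 0%N isT).
rewrite mem_set; last by [].
by move=> /eqP; rewrite eq_sym oner_eq0.
Qed.

(** A nonzero row of a support point recurs in arbitrarily late blocks. Its entries are bounded, so
    they cannot be the escaping ones and come from a sequence in P; lowering them by one gives the
    branch. *)
Lemma limit_tree_point_inv (nu : prob_measure R baire) :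
  (forall s t, P (s ++ t) -> P s) ->
  limit_measures shift (tree_point P) nu -> nu <> mu0 ->
  exists b : nat -> nat, forall n, P (mkseq b n).
Proof.
move=> Ppre xnu nuN; have [z zN zP] := support_point nuN.
have [m zm] : exists m, z m <> 0%N.
  by apply: contrapT => h; apply: zN; apply/funext => m; apply: contrapT => zm; apply: h; exists m.
pose a := row_index m; exists (fun l => (z (coord a l)).-1) => n.
(* Length n + 1 provides an entry at which to read off that the sequence of the block is in P, even
   for n = 0. *)
suff : P (mkseq (fun l => (z (coord a l)).-1) n.+1).
  by rewrite mkseqS -cats1 => /Ppre.
pose V := \max_(l < n.+1) z (coord a l).
pose J := maxn m (\max_(l < n.+1) coord a l).
(* After this time the block index is at least 2V + 2, so its half exceeds the bound V on the
   relevant entries of [z]. *)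
have [i Vi zi] := support_recurrent (V.*2.+3)`! xnu (zP J.+1).
have {}zi l : (l <= J)%N ->
    z l = tree_rows P (i + row_index l) (col_index l).
  by move=> lJ; rewrite zi// iter_shift_of_rows.
have zc l : (l < n.+1)%N -> z (coord a l) = tree_rows P (i + a) l.
  move=> ln; rewrite zi ?row_coord ?col_coord//; apply: leq_trans (leq_maxr _ _).
  exact: (leq_bigmax (Ordinal ln)).
have Vb : (V.*2.+2 <= block (i + a))%N.
  by apply: block_ge; apply: leq_trans Vi _; apply: leqW; exact: leq_addr.
(* Coordinate m of [z] is nonzero and lies in row a, whereas even blocks hold zero rows. *)
have ob : odd (block (i + a)).
  have := zi m (leq_maxl _ _); rewrite /tree_rows -/a; case: odd => //.
pose j := (block (i + a))./2; pose s := CodeSeq.decode j.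
have Vj : (V < j)%N.
  by rewrite /j; have := half_leq Vb; rewrite -doubleS doubleK.
have key l : (l < n.+1)%N ->
    [/\ P s, (l < size s)%N & nth 0%N s l = (z (coord a l)).-1].
  move=> ln; have := zc l ln; rewrite /tree_rows ob /tree_row -/j -/s.
  have zV : (z (coord a l) <= V)%N.
    exact: (leq_bigmax (F := fun l : 'I_n.+1 => z (coord a l)) (Ordinal ln)).
  case: ifP => [/andP[/asboolP Ps ls]|_] zl; first by rewrite zl.
  by move: zV; rewrite zl => /leq_ltn_trans/(_ Vj); rewrite ltnNge leqnSn.
have [Ps ns _] := key n (ltnSn n).
have e : take n.+1 s = mkseq (fun l => (z (coord a l)).-1) n.+1.
  apply: (@eq_from_nth _ 0%N); rewrite size_takel// ?size_mkseq// => l ln.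
  by rewrite nth_take// nth_mkseq//; have [] := key l ln.
by rewrite -e; apply: (Ppre _ (drop n.+1 s)); rewrite cat_take_drop.
Qed.

End tree_point_limits.

(** Each coordinate depends on y only through the membership of a single finite sequence in [S y], a
    clopen condition. *)
Lemma continuous_tree_point (Y : topologicalType) (S : Y -> seq nat -> Prop) :
  (forall s, clopen [set y | S y s]) -> continuous (fun y => tree_point (S y)).
Proof.
move=> Scl y.
suff H k : \forall y' \near y, agree k (tree_point (S y)) (tree_point (S y')).
  by move=> A [k kA]; apply: filterS (H k) => y'; exact: kA.
elim: k => [|k ih]; first exact: nearW.
have : \forall y' \near y, tree_point (S y) k = tree_point (S y') k.
  set s := CodeSeq.decode (block (row_index k))./2.
  apply: filterS (clopen_near y (Scl s)) => y' /= e.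
  by rewrite /tree_point /of_rows /tree_rows /tree_row -/s e.
move: ih; apply: filterS2 => y' h1 h2 i; rewrite ltnS leq_eqVlt.
by move=> /predU1P[->//|]; exact: h1.
Qed.

(** * Completeness of the three sets *)

Section completeness.
Variable R : realType.
Local Notation mu0 := (dirac_prob R zero).
Local Notation U :=
  [set nu : prob_measure R baire | invariant_measures shift nu /\ nu <> mu0].

(** The last clause lets one reduction serve all three sets: on the image of f, where [mu0] is
    always a limit, [G_eq] and [G_sub] coincide. *)
Lemma analytic_reduction (Y : topologicalType) (B : set Y) :
  polish R Y -> clopen_base Y -> analytic R B ->
  exists f : Y -> baire, [/\ continuous f, B = f @^-1` G_meet shift U
    & forall y, limit_measures shift (f y) mu0].
Proof.
move=> pY cb /(analytic_tree pY cb) [S [Scl Spre SP]].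
exists (fun y => tree_point (S y)); split.
- exact: continuous_tree_point.
- apply/seteqP; split=> y.
    move=> /SP[b bP]; have [nu [xnu nuN]] := limit_tree_point_branch R bP.
    exists nu; split=> //; split=> //; exact: limit_measures_invariant xnu.
  move=> [nu [xnu [_ nuN]]]; apply/SP.
  exact: limit_tree_point_inv (Spre y) xnu nuN.
- by move=> y; exact: limit_tree_point_zero.
Qed.

Lemma analytic_complete_G_meet : analytic_complete R (G_meet shift U).
Proof.
split; first exact: analytic_G_meet.
move=> Y pY cb B /(analytic_reduction pY cb)[f [cf Bf _]].
by exists f.
Qed.

Lemma coanalytic_complete_G_sub : coanalytic_complete R (G_sub shift [set mu0]).
Proof.
split.
  by rewrite /coanalytic -G_meetE; exact: analytic_G_meet.
move=> Y pY cb B /(analytic_reduction pY cb)[f [cf Bf _]].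
by exists f => //; rewrite -[LHS]setCK Bf G_meetE -preimage_setC setCK.
Qed.

Lemma coanalytic_complete_G_eq : coanalytic_complete R (G_eq shift [set mu0]).
Proof.
split; first exact: coanalytic_G_eq.
move=> Y pY cb B /(analytic_reduction pY cb)[f [cf Bf f0]].
exists f => //; rewrite -[LHS]setCK Bf G_meetE -preimage_setC setCK G_eqE.
by apply/seteqP; split=> y /= => [h|[]//]; split=> //; exact: f0.
Qed.

End completeness.

Theorem theorem33 (R : realType) :
  exists (X : ptopologicalType) (rho : X -> X -> R) (T : X -> X)
         (mu : prob_measure R X),
    let V : set (prob_measure R X) := [set mu] in
    let U : set (prob_measure R X) :=
      [set nu | invariant_measures T nu /\ nu <> mu] in
    [/\ polish_dynamical_system rho T,
        specification rho T,
        [/\ V `<=` invariant_measures T, closed V, connected V & V !=set0],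
        coanalytic_complete R (G_eq T V)
      & coanalytic_complete R (G_sub T V) /\ analytic_complete R (G_meet T U)].
Proof.
exists baire, (@rho R), shift, (dirac_prob R zero) => V U; split.
- exact: polish_dynamical_system_shift.
- exact: specification_shift.
- split.
  + by move=> _ ->; exact: invariant_dirac0.
  + exact: closed_prob1.
  + exact: connected1.
  + by exists (dirac_prob R zero).
- exact: coanalytic_complete_G_eq.
- split; first exact: coanalytic_complete_G_sub.
  exact: analytic_complete_G_meet.
Qed.
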